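(* Let $\Gamma$, given by $\sum_{i=0}^kQ_i(z)w^i=0$, be a plane curve of general type. Then each branch near infinity $w=w(z)$ of an algebraic function satisfying $\sum_{i=0}^kQ_i(z)w^i=0$ is a positive Cauchy transform multiplied by an appropriate constant; that is, there exist a constant $c\in\mathbb{C}$ and a probability measure $\mu$ with compact support in $\mathbb{C}$ such that $w(z)=c\int_{\mathbb{C}}\frac{d\mu(\xi)}{z-\xi}$ in a neighborhood of $z=\infty$.
   Context: Here each $Q_i(z)=\sum_{j=0}^ia_{i,j}z^j$ is a complex polynomial of degree at most $i$. The curve $\Gamma$ is of general type if (i) $\deg Q_k=k$ (i.e. $a_{k,k}\ne0$), and (ii) no two roots of the characteristic equation $a_{k,k}+a_{k-1,k-1}t+\dots+a_{0,0}t^k=0$ lie on a line through the origin (in particular, $0$ is not a root). It is understood that the characteristic equation has $k$ distinct roots (so $a_{0,0}\neq 0$). *)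

(* Defs.v *)
(* The complex plane is R[i] for R : realType; its topology and normed-module
   structure are carried by the convertible alias R[i]^o. *)
From HB Require Import structures.
From mathcomp Require Import all_boot all_order all_algebra.
From mathcomp Require Import all_classical all_reals all_analysis.
From mathcomp Require Import complex.

Set Implicit Arguments.
Unset Strict Implicit.
Unset Printing Implicit Defensive.

Import Order.TTheory GRing.Theory Num.Theory.
Import numFieldNormedType.Exports.

Local Open Scope classical_set_scope.
Local Open Scope ring_scope.
Local Open Scope complex_scope.

Definition near_infty (R : realType) (P : R[i] -> Prop) : Prop :=
  exists M : R, forall z : R[i], M%:C < `|z| -> P z.

(* R[i] as a type has no canonical sigma-algebra; this one is the Borel one. *)
Notation borelC R := (g_sigma_algebraType (@open R[i]^o)).

Definition msupport (R : realType) (mu : probability (borelC R) R) :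
    set R[i]^o :=
  [set x : R[i]^o | forall U : set R[i]^o, open U -> U x -> (0 < mu U)%E].

(* Rintegral is 0 by convention on non-integrable functions.  When mu has
   compact support this can only occur for z in that support, hence never for
   z in a neighborhood of infinity. *)
Definition cauchy_transform (R : realType) (mu : probability (borelC R) R)
    (z : R[i]) : R[i] :=
  Rintegral mu setT (fun xi : R[i] => complex.Re ((z - xi)^-1)) +i*
  Rintegral mu setT (fun xi : R[i] => complex.Im ((z - xi)^-1)).

Section Curve.
Variables (R : realType) (k : nat) (Q : 'I_k.+1 -> {poly R[i]}).

(* Its roots are the candidates for 1 / lim (z * w z) along a branch w at
   infinity of the curve. *)
Definition char_poly_at_infty : {poly R[i]} :=
  \sum_(i < k.+1) (Q i)`_i *: 'X^(k - i).

Definition collinear0 (s t : R[i]) : Prop :=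
  exists2 v : R[i], v != 0 &
    exists a b : R, s = a%:C * v /\ t = b%:C * v.

(* Since a_(k,k) <> 0, having k distinct roots forces the characteristic
   polynomial to have degree exactly k, i.e. a_(0,0) <> 0. *)
Definition general_type : Prop :=
  [/\ forall i : 'I_k.+1, (size (Q i) <= i.+1)%N,
      size (Q ord_max) = k.+1,
      exists s : seq R[i],
        [/\ uniq s, size s = k & all (root char_poly_at_infty) s] &
      forall s t : R[i], root char_poly_at_infty s ->
        root char_poly_at_infty t -> s != t -> ~ collinear0 s t].

(* derivable over the field R[i], in the direction 1, is complex
   differentiability; w is thus a single-valued holomorphic solution on some
   domain |z| > M, with arbitrary values elsewhere. *)
Definition branch_near_infty (w : R[i] -> R[i]) : Prop :=
  near_infty (fun z => derivable (w : R[i]^o -> R[i]^o) z 1 /\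
                       \sum_(i < k.+1) (Q i).[z] * w z ^+ i = 0).
End Curve.

(* Main.v *)
Require Import Defs.
From HB Require Import structures.
From mathcomp Require Import all_boot all_order all_algebra.
From mathcomp Require Import all_classical all_reals all_analysis.
From mathcomp Require Import measurable_realfun complex.
From mathcomp Require Import ring lra.

(** Put [t = 1 / z] and [u = z * w].  The equation of the curve becomes a
    polynomial relation [G (t, u) = 0], and [G (0, u)] has degree [k] and [k]
    distinct nonzero roots, the inverses of the roots of the characteristic
    polynomial.  Near infinity [u] is close to the set of these roots
    ([root_near_root]), hence close to one and the same root [c] since the
    exterior of a disc is connected ([near_root_exterior]).  As [c] is a simple
    root, [u = c * (1 + m_1 t + m_2 t^2 + ...)] for a convergent power series
    ([simple_root_series], [branch_expansion]).

    It remains to see that every germ [c / z * (1 + m_1 / z + m_2 / z^2 + ...)]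
    with [c <> 0] is [c] times the Cauchy transform of a probability measure.
    Near infinity a Cauchy transform only depends on the holomorphic moments of
    the measure, the integrals of [xi^n]; nothing is imposed on its other
    moments, and this leaves enough freedom to realize any sequence
    [1, m_1, m_2, ...] of at most geometric growth.  The measure built here is
    discrete.  The uniform measure on the solutions of [x^d = a] has Cauchy
    transform [1 / z * 1 / (1 - a z^-d)]: its moment of order [j d] is [a^j]
    and the others vanish.  Mixing these measures with weights
    [p_d = 1 / (d (d + 1))], of total mass 1, gives as moment of order [n] the
    sum of [p_d a_d^(n / d)] over the divisors [d] of [n].  The term [d = n] is
    [p_n a_n], so that [a_1, a_2, ...] can be computed one after the other
    from the prescribed moments.  The terms with [d < n] involve powers of
    exponent at least 2, which keeps them small enough for [|a_n| <= B^n / 16]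
    to propagate along the recursion ([normc_atom]).  Hence all the atoms lie
    in the disc of radius [B], the support is compact, and the partial mixtures
    converge to the germ ([atoms_approx], [positive_cauchy]). *)

Set Implicit Arguments.
Unset Strict Implicit.
Unset Printing Implicit Defensive.

Import Order.TTheory GRing.Theory Num.Theory.
Import numFieldNormedType.Exports.
Import ComplexField.Normc.

Local Open Scope ring_scope.
Local Open Scope complex_scope.

(** * The real-valued modulus *)

Section NormC.
Variable R : rcfType.
Implicit Types x y z : R[i].

(** The order of [R[i]] is partial and [`|z|] is an element of [R[i]]; all
    estimates are made in [R] instead, through this equation. *)
Lemma normr_normc z : `|z| = real_complex R (normc z).
Proof. by case: z => a b; rewrite normc_def. Qed.

Lemma normc_ge0 z : 0 <= normc z.
Proof. by case: z => a b; apply: sqrtr_ge0. Qed.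

Lemma normc_eq0 z : (normc z == 0) = (z == 0).
Proof.
apply/eqP/eqP => [/eq0_normc //|->].
exact: normc0.
Qed.

Lemma normc_gt0 z : (0 < normc z) = (z != 0).
Proof. by rewrite lt_def normc_eq0 normc_ge0 andbT. Qed.

Lemma normcX z n : normc (z ^+ n) = normc z ^+ n.
Proof.
elim: n => [|n IH]; first by rewrite !expr0 normc1.
by rewrite !exprS normcM IH.
Qed.

Lemma normcB x y : normc (x - y) <= normc x + normc y.
Proof. by rewrite -(normcN y) le_normcD. Qed.

Lemma normc_distC x y : normc (x - y) = normc (y - x).
Proof. by rewrite -normcN opprB. Qed.

Lemma normc_real (r : R) : normc (real_complex R r) = `|r|.
Proof. by rewrite /= expr0n addr0 sqrtr_sqr. Qed.

Lemma normc_sum I (r : seq I) (P : pred I) (F : I -> R[i]) :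
  normc (\sum_(i <- r | P i) F i) <= \sum_(i <- r | P i) normc (F i).
Proof.
elim/big_rec2: _ => [|i x y _ h]; first by rewrite normc0.
exact: le_trans (le_normcD _ _) (lerD _ h).
Qed.

Lemma normc_ge_normRe z : `|complex.Re z| <= normc z.
Proof. by rewrite -lecR -normr_normc normc_ge_Re. Qed.

Lemma normc_ge_normIm z : `|complex.Im z| <= normc z.
Proof.
case: z => a b /=; rewrite -sqrtr_sqr ler_wsqrtr // lerDr.
exact: sqr_ge0.
Qed.

End NormC.

(** * Contractions in a seminormed ring *)

Section Contraction.
Variables (R : realFieldType) (A : comNzRingType) (N : A -> R).
Hypotheses (N0 : N 0 = 0) (N1 : N 1 <= 1) (Nge0 : forall x, 0 <= N x)
  (ND : forall x y, N (x + y) <= N x + N y)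
  (NM : forall x y, N (x * y) <= N x * N y).

Lemma seminorm_sum I (r : seq I) (P : pred I) (F : I -> A) :
  N (\sum_(i <- r | P i) F i) <= \sum_(i <- r | P i) N (F i).
Proof.
elim/big_rec2: _ => [|i x y _ h]; first by rewrite N0.
exact: le_trans (ND _ _) (lerD _ h).
Qed.

Lemma seminormX x n : N (x ^+ n) <= N x ^+ n.
Proof.
elim: n => [|n IH]; first by rewrite !expr0.
by rewrite !exprS (le_trans (NM _ _)) // ler_wpM2l.
Qed.

Lemma seminorm_subX (d : R) x y n : N x <= d -> N y <= d ->
  N (x ^+ n.+1 - y ^+ n.+1) <= n.+1%:R * d ^+ n * N (x - y).
Proof.
move=> xd yd; rewrite subrXX (le_trans (NM _ _)) // mulrC ler_wpM2r //.
rewrite (le_trans (seminorm_sum _ _ _)) //.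
rewrite mulr_natl -[n.+1 in leRHS]card_ord -sumr_const ler_sum // => i _.
rewrite (le_trans (NM _ _)) //.
rewrite /= -[in leRHS](subnK (_ : i <= n)%N) 1?exprD; last by rewrite -ltnS.
by rewrite ler_pM // (le_trans (seminormX _ _)) // lerXn2r ?nnegrE // (le_trans _ xd).
Qed.

(** The constant term cancels in the difference, the linear term is contracted
    because its coefficient is small, and the terms of degree [j >= 2] because
    [x ^ j - y ^ j] is [x - y] times [j] products of [j - 1 >= 1] factors of
    size at most [d].  The statement holds in any seminormed ring because it
    serves twice: for formal power series, with the weighted norm of
    polynomials, and for their values, with the modulus. *)
Lemma horner_contraction (H : {poly A}) (kappa C d : R) x y :
  (size H)%:R * kappa <= 2^-1 -> C * (size H)%:R * d <= kappa ->
  0 <= d <= 1 ->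
  N H`_1 <= kappa -> (forall j, N H`_j <= C) ->
  N x <= d -> N y <= d ->
  N (H.[x] - H.[y]) <= 2^-1 * N (x - y).
Proof.
move=> hk hC /andP[d0 d1] h1 hj xd yd.
rewrite !horner_coef -sumrB (le_trans (seminorm_sum _ _ _)) //.
have k0 : 0 <= kappa by apply: le_trans h1.
have C0 : 0 <= C by apply: le_trans (hj 0%N).
have : \sum_(j < size H) N (H`_j * x ^+ j - H`_j * y ^+ j) <=
       \sum_(j < size H) kappa * N (x - y).
  apply: ler_sum => -[j /= jH] _; rewrite -mulrBr.
  case: j jH => [|[|n]] jH; first by rewrite !expr0 subrr mulr0 N0 mulr_ge0.
    by rewrite !expr1 (le_trans (NM _ _)) // ler_wpM2r.
  rewrite (le_trans (NM _ _)) //.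
  apply: (@le_trans _ _ (C * (n.+2%:R * d ^+ n.+1 * N (x - y)))).
    by rewrite ler_pM // seminorm_subX.
  rewrite !mulrA ler_wpM2r // (le_trans _ hC) // ler_pM ?mulr_ge0 ?exprn_ge0 //.
    by rewrite ler_wpM2l // ler_nat ltnW.
  by rewrite exprS ler_piMr // exprn_ile1.
move/le_trans; apply.
by rewrite sumr_const card_ord -mulrnAl ler_wpM2r // -mulr_natl.
Qed.

End Contraction.

(** * Weighted norms of polynomials *)

Section WeightedNorm.
Variable R : rcfType.
Implicit Types (p q : {poly R[i]}) (rho : R).

(** With it the weighted norm [sum |p_i| rho^i] is the value at [rho] of a
    real polynomial, so that submultiplicativity follows from the ring
    morphism property of evaluation and coefficientwise comparison. *)
Definition abs_poly p : {poly R} := map_poly (fun z : R[i] => normc z) p.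
Definition wnorm rho p : R := (abs_poly p).[rho].

Lemma coef_abs_poly p i : (abs_poly p)`_i = normc p`_i.
Proof. by rewrite coef_map_id0 // normc0. Qed.

Lemma le_horner_coef (p q : {poly R}) rho : 0 <= rho ->
  (forall i, p`_i <= q`_i) -> p.[rho] <= q.[rho].
Proof.
move=> r0 pq; set n := maxn (size p) (size q).
rewrite (@horner_coef_wide _ n p) ?leq_maxl // (@horner_coef_wide _ n q) ?leq_maxr //.
by apply: ler_sum => i _; rewrite ler_wpM2r // exprn_ge0.
Qed.

Section Fixed.
Variable rho : R.
Hypothesis rho0 : 0 <= rho.

Lemma wnorm_ge0 p : 0 <= wnorm rho p.
Proof.
by rewrite -[leLHS](horner0 rho) le_horner_coef // => i; rewrite coef0 coef_abs_poly normc_ge0.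
Qed.

Lemma wnormC (c : R[i]) : wnorm rho c%:P = normc c.
Proof.
rewrite /wnorm (_ : abs_poly _ = (normc c)%:P) ?hornerC //.
apply/polyP => i; rewrite coef_abs_poly !coefC.
by case: eqP => // _; rewrite normc0.
Qed.

Lemma wnormD p q : wnorm rho (p + q) <= wnorm rho p + wnorm rho q.
Proof.
rewrite /wnorm -hornerD le_horner_coef // => i.
by rewrite coefD !coef_abs_poly coefD le_normcD.
Qed.

Lemma wnormM p q : wnorm rho (p * q) <= wnorm rho p * wnorm rho q.
Proof.
rewrite /wnorm -hornerM le_horner_coef // => i.
rewrite coef_abs_poly !coefM (le_trans (normc_sum _ _ _)) // ler_sum // => j _.
by rewrite normcM !coef_abs_poly.
Qed.

Lemma wnormMXn p n : wnorm rho (p * 'X^n) = wnorm rho p * rho ^+ n.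
Proof.
rewrite /wnorm -[rho ^+ n]hornerXn -hornerM; congr (_.[_]).
apply/polyP => i; rewrite coef_abs_poly !coefMXn coef_abs_poly.
by case: ifP => // _; rewrite normc0.
Qed.

(** Dividing the tail of [p] by ['X^n] costs a factor [rho ^- n]; evaluating
    at a point of modulus at most [rho / 2] thus leaves a tail of size [2 ^-
    n]. *)
Lemma wnorm_drop p n : wnorm rho (drop_poly n p) * rho ^+ n <= wnorm rho p.
Proof.
rewrite -wnormMXn le_horner_coef // => i; rewrite !coef_abs_poly coefMXn.
case: ltnP => [_|ni]; first by rewrite normc0 normc_ge0.
by rewrite coef_drop_poly subnK.
Qed.

Lemma wnorm_coef p n : normc p`_n * rho ^+ n <= wnorm rho p.
Proof.
rewrite -coef_abs_poly -hornerXn -[_ * _]hornerZ le_horner_coef // => i.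
rewrite coefZ coefXn; case: eqP => [->|_]; first by rewrite mulr1.
by rewrite mulr0 coef_abs_poly normc_ge0.
Qed.

Lemma wnorm_horner p t : normc t <= rho -> normc p.[t] <= wnorm rho p.
Proof.
move=> tr; rewrite /wnorm horner_coef (le_trans (normc_sum _ _ _)) //.
rewrite (@horner_coef_wide _ (size p)); last first.
  by apply/leq_sizeP => j jp; rewrite coef_abs_poly nth_default // normc0.
apply: ler_sum => i _; rewrite normcM coef_abs_poly.
by rewrite ler_wpM2l ?normc_ge0 // normcX lerXn2r ?nnegrE ?normc_ge0.
Qed.

End Fixed.

Lemma wnorm_le rho p : 0 <= rho <= 1 -> wnorm rho p <= wnorm 1 p.
Proof.
case/andP => r0 r1.
rewrite /wnorm !horner_coef ler_sum // => i _.
rewrite coef_abs_poly ler_wpM2l ?normc_ge0 // expr1n exprn_ile1 //.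
Qed.

(** This is where the smallness of [rho] comes in: what vanishes at [t = 0] is
    small on a small disc. *)
Lemma wnorm_root0 rho p : 0 <= rho <= 1 -> p.[0] = 0 ->
  wnorm rho p <= rho * wnorm 1 p.
Proof.
move=> r01 /eqP/factor_theorem[q ->]; have /andP[r0 _] := r01.
rewrite subr0 -['X]expr1 !wnormMXn !expr1 mulr1 mulrC.
by rewrite ler_wpM2l // wnorm_le.
Qed.

End WeightedNorm.

(** * Power series solutions of fixed point equations *)

(** The three smallness conditions are met one after the other: [kap] from the
    number of coefficients, then the radius [d] of the ball of values from
    [kap], then the radius [rho] of the disc of parameters from [d]. *)
Lemma contraction_constants (R : realFieldType) (k C : R) : 0 <= k -> 1 <= C ->
  exists kap d rho : R,
  [/\ 0 < rho, rho <= 1, 0 < d, d <= 1 & d <= kap] /\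
  [/\ rho * C <= d / 2, k * kap <= 2^-1 & C * k * d <= kap].
Proof.
move=> k0 C1.
have [kap kapE] : exists kap, kap * (2 * (k + 1)) = 1.
  by exists (2 * (k + 1))^-1; rewrite mulVf //; lra.
have kap0 : 0 < kap.
  by rewrite -(pmulr_lgt0 _ (_ : 0 < 2 * (k + 1))) ?kapE //; lra.
have [d dE] : exists d, d * (C * (k + 1)) = kap.
  by exists (kap / (C * (k + 1))); rewrite mulfVK //; nra.
have Ck1 : 1 <= C * (k + 1) by nra.
have d0 : 0 < d by rewrite -(pmulr_lgt0 _ (_ : 0 < C * (k + 1))) ?dE //; lra.
have [rho rhoE] : exists rho, rho * (2 * C) = d.
  by exists (d / (2 * C)); rewrite mulfVK //; lra.
have rho0 : 0 < rho by rewrite -(pmulr_lgt0 _ (_ : 0 < 2 * C)) ?rhoE //; lra.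
have dk : d <= kap by nra.
exists kap, d, rho; split; split => //; nra.
Qed.

Lemma half_le (R : realFieldType) (x : R) : 0 <= x -> x / 2 <= x.
Proof. lra. Qed.

Lemma le_half_add (R : realFieldType) (x y z d : R) :
  x <= 2^-1 * y -> y <= d -> z <= d / 2 -> x + z <= d.
Proof. lra. Qed.

Section FixedPoint.
Variable R : rcfType.
Variable H : {poly {poly R[i]}}.
Hypotheses (H0 : (H`_0).[0] = 0) (H1 : (H`_1).[0] = 0).

(** Picard iteration for [v = H (t, v)], started at 0 and carried out on
    polynomials in [t]. *)
Definition picard n : {poly R[i]} := iter n (fun p => H.[p]) 0.

(** Every step of the iteration fixes one more coefficient: [H.[x] - H.[y]] is
    divisible by ['X (x - y)] when [x] and [y] are divisible by ['X], because
    the linear coefficient of [H] vanishes at 0 and the terms of higher degree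
    contain a further factor [x] or [y]. *)
Lemma dvdXn_picardS n : dvdp 'X^(n.+1) (picard n.+1 - picard n).
Proof.
have dX (p : {poly R[i]}) : p.[0] = 0 -> dvdp 'X p.
  by move=> p0; rewrite -['X]subr0 dvdp_XsubCl; apply/rootP.
have dH (x y : {poly R[i]}) m : dvdp 'X x -> dvdp 'X y -> dvdp 'X^m (x - y) -> dvdp 'X^(m.+1) (H.[x] - H.[y]).
  move=> dx dy dxy; rewrite !horner_coef -sumrB.
  elim/big_ind: _ => [|p q|[j /= _] _]; [exact: dvdp0|exact: dvdp_add|].
  rewrite -mulrBr; case: j => [|[|j]]; first by rewrite subrr mulr0 dvdp0.
    by rewrite !expr1 exprS; apply: dvdp_mul => //; apply: dX.
  apply: dvdp_mull; rewrite subrXX exprSr; apply: dvdp_mul => //=.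
  elim/big_ind: _ => [|p q|[i /= ij] _]; [exact: dvdp0|exact: dvdp_add|].
  case: i ij => [|i] ij; first by rewrite subn0 expr0 mulr1 exprS; apply: dvdp_mulr.
  by rewrite dvdp_mull // exprS; apply: dvdp_mulr.
have d1 m : dvdp 'X (picard m).
  elim: m => [|m IH]; first exact: dvdp0.
  have := dH _ 0 0%N IH (dvdp0 _); rewrite expr0 dvd1p expr1 => /(_ isT) h.
  rewrite -(dvdp_addl _ (_ : dvdp 'X (- H.[0]))) ?h // dvdpNr horner_coef0.
  exact: dX.
elim: n => [|n IH]; first by rewrite subr0 expr1 d1.
by apply: dH => //; apply: (d1 n.+1).
Qed.

(** The coefficients of the formal solution.  As they are stationary along the
    iteration, no limit has to be taken. *)
Definition picard_coef n : R[i] := (picard n)`_n.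

Lemma coef_picard N n : (n <= N)%N -> (picard N)`_n = picard_coef n.
Proof.
move/subnK <-; elim: (N - n)%N => [//|m IH]; rewrite addSn -IH.
apply/eqP; rewrite -subr_eq0 -coefB.
have /dvdpP[q ->] := dvdXn_picardS (m + n).
by rewrite coefMXn ltnS leq_addl.
Qed.

Lemma take_picard N : take_poly N.+1 (picard N) = \poly_(n < N.+1) picard_coef n.
Proof.
apply/polyP => n; rewrite coef_take_poly coef_poly; case: ifP => //.
by rewrite ltnS => /coef_picard.
Qed.

(** The Picard iterates stay in a ball for the weighted norm, which bounds the
    coefficients geometrically.  For a fixed [t] the same contraction
    estimate, now for the modulus, shows that the values of the iterates
    converge to any small solution [v] of [v = H (t, v)]; the part of degree
    larger than [N] of the [N]-th iterate is small by [wnorm_drop].  Hence [v]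
    is the sum of the series. *)
Lemma fixed_point_series : exists rho K d : R,
  [/\ 0 < rho, 0 < d, 0 < K, forall n, normc (picard_coef n) * rho ^+ n <= K &
   forall t v : R[i], normc t <= rho / 2 -> normc v <= d ->
     (map_poly (horner_eval t) H).[v] = v ->
   forall N, normc (v - \sum_(n < N.+1) picard_coef n * t ^+ n) <= K / 2 ^+ N ].
Proof.
pose C : R := 1 + \sum_(j < size H) wnorm 1 H`_j.
have S0 : 0 <= \sum_(j < size H) wnorm 1 H`_j.
  by apply: sumr_ge0 => i _; apply: wnorm_ge0.
have C1 : 1 <= C by rewrite lerDl.
have hC j : wnorm 1 H`_j <= C.
  case: (ltnP j (size H)) => jH.
    rewrite /C (bigD1 (Ordinal jH)) //= addrCA lerDl addr_ge0 //.
    by apply: sumr_ge0 => i _; apply: wnorm_ge0.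
  by rewrite nth_default // wnormC // normc0 (le_trans ler01).
clearbody C; clear S0.
have [kap [d [rho [[rho0 rho1 d0 d1 dk] [rhoE hs hs2]]]]] :=
  contraction_constants (ler0n R (size H)) C1.
have r0 := ltW rho0.
have rho01 : 0 <= rho <= 1 by rewrite r0.
have kap0 := lt_le_trans d0 dk.
have C0 := le_trans ler01 C1.
have hsmall p : p.[0] = 0 -> wnorm 1 p <= C -> wnorm rho p <= d / 2.
  move=> p0 pC; apply: le_trans (wnorm_root0 rho01 p0) _.
  by apply: le_trans rhoE; rewrite ler_wpM2l.
have d2 : d / 2 <= d by rewrite half_le // ltW.
have h0 : wnorm rho H`_0 <= d / 2 by apply: hsmall.
have h1 : wnorm rho H`_1 <= kap by rewrite (le_trans (hsmall _ H1 (hC _))) // (le_trans d2).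
have hj j : wnorm rho H`_j <= C by rewrite (le_trans (wnorm_le _ rho01)).
have N1 : wnorm rho 1 <= 1 by rewrite wnormC // normc1.
have N0 : wnorm rho 0 = 0 by rewrite wnormC // normc0.
have d01 : 0 <= d <= 1 by rewrite ltW.
have contr x y : wnorm rho x <= d -> wnorm rho y <= d ->
    wnorm rho (H.[x] - H.[y]) <= 2^-1 * wnorm rho (x - y).
  apply: (@horner_contraction _ _ _ _ _ _ _ _ _ kap C) => //.
  - exact: wnorm_ge0.
  - exact: wnormD.
  - exact: wnormM.
have pd n : wnorm rho (picard n) <= d.
  elim: n => [|n IH]; first by rewrite N0 ltW.
  rewrite [picard _](_ : _ = (H.[picard n] - H.[0]) + H.[0]); last by rewrite subrK.
  rewrite (le_trans (wnormD _ _ _)) // horner_coef0.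
  have := contr _ 0 IH; rewrite N0 subr0 horner_coef0 => /(_ (ltW d0)) h.
  exact: le_half_add h IH h0.
exists rho, (2 * d), d; split => //; first by rewrite mulr_gt0.
  move=> n; rewrite (le_trans (wnorm_coef _ _ _)) //.
  by apply: le_trans (pd n) _; rewrite ler_peMl ?ltW // ltr1n.
move=> t v tr vd vfix N.
have tr' : normc t <= rho by rewrite (le_trans tr) // half_le.
have eN n : normc (v - (picard n).[t]) <= d / 2 ^+ n.
  elim: n => [|n IH]; first by rewrite horner0 subr0 expr0 divr1.
  have -> : v - (picard n.+1).[t] =
    (map_poly (horner_eval t) H).[v] - (map_poly (horner_eval t) H).[(picard n).[t]].
    by rewrite vfix -[(picard n).[t]]/(horner_eval t (picard n)) horner_map.
  have sz : (size (map_poly (horner_eval t) H))%:R <= (size H)%:R :> R by rewrite ler_nat size_poly.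
  have hm j : normc (map_poly (horner_eval t) H)`_j <= wnorm rho H`_j.
    rewrite coef_map; exact: wnorm_horner.
  apply: le_trans (_ : 2^-1 * normc (v - (picard n).[t]) <= _); last first.
    by rewrite exprS invfM mulrCA ler_wpM2l // invr_ge0.
  apply: (@horner_contraction _ _ (fun z : R[i] => normc z) _ _ _ _ _ _ kap C d) => //.
  - exact: normc0.
  - by rewrite normc1.
  - exact: normc_ge0.
  - exact: le_normcD.
  - by move=> x y; rewrite normcM.
  - by apply: le_trans hs; rewrite ler_wpM2r // ltW.
  - by apply: le_trans hs2; rewrite ler_wpM2r ?(ltW d0) // ler_wpM2l.
  - by apply: le_trans h1; apply: hm.
  - by move=> j; apply: le_trans (hj j); apply: hm.
  - by apply: le_trans (pd n); apply: wnorm_horner.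
have -> : v - \sum_(n < N.+1) picard_coef n * t ^+ n =
    (v - (picard N).[t]) + (drop_poly N.+1 (picard N)).[t] * t ^+ N.+1.
  rewrite -{1}(poly_take_drop N.+1 (picard N)) take_picard hornerD hornerM hornerXn.
  by rewrite horner_poly; ring.
rewrite (le_trans (le_normcD _ _)) //.
have -> : 2 * d / 2 ^+ N = d / 2 ^+ N + d / 2 ^+ N by ring.
rewrite lerD // normcM normcX.
apply: le_trans (_ : wnorm rho (drop_poly N.+1 (picard N)) * (rho ^+ N.+1 / 2 ^+ N.+1) <= _).
  rewrite ler_pM ?normc_ge0 ?exprn_ge0 ?normc_ge0 // ?wnorm_horner //.
  by rewrite -expr_div_n lerXn2r ?nnegrE ?normc_ge0 // divr_ge0.
rewrite mulrA ler_pM ?invr_ge0 ?exprn_ge0 //.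
- by rewrite mulr_ge0 ?wnorm_ge0 ?exprn_ge0.
- by apply: le_trans (wnorm_drop _ _ _) _.
- by rewrite lef_pV2 ?posrE ?exprn_gt0 // ler_eXn2l // ltr1n.
Qed.

End FixedPoint.

(** * Roots of a polynomial depending on a parameter *)

(** Away from a point of modulus at most [S], the distance to it controls the
    modulus. *)
Lemma far_bound (R : realFieldType) (d S K x y c : R) :
  0 < d -> d <= 1 -> 0 <= S -> K * d = 1 + S -> d <= x -> y <= x + c -> c <= S ->
  Num.max 1 y <= K * x.
Proof.
move=> d0 d1 S0 Kd dx yx cS.
have K1 : 1 <= K by rewrite -(ler_pM2r d0) Kd mul1r; lra.
have h1 : K * d <= K * x by rewrite ler_wpM2l //; lra.
have h2 : (K - 1) * d <= (K - 1) * x by rewrite ler_wpM2l //; lra.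
by rewrite ge_max; apply/andP; split; nra.
Qed.

Lemma half_lt_absurd (R : realFieldType) (x y : R) : 0 < x -> x <= y -> y <= x / 2 -> False.
Proof. lra. Qed.

Section Perturbation.
Variable R : rcfType.
Local Notation C := R[i].
Variables (G : {poly {poly C}}).

Local Notation Gat t := (map_poly (horner_eval t) G).

(** Replacing the parameter [t] by 0 changes every coefficient by [O (rho)],
    while [m] bounds the powers of the variable. *)
Lemma horner_drift : exists2 B : R, 0 <= B &
  forall (rho m : R) (t u : C), 0 <= rho <= 1 -> normc t <= rho -> 1 <= m -> normc u <= m ->
    normc ((Gat t).[u] - (Gat 0).[u]) <= rho * B * m ^+ (size G).-1.
Proof.
exists (\sum_(i < size G) wnorm 1 (G`_i - ((G`_i).[0])%:P)).
  by apply: sumr_ge0 => i _; apply: wnorm_ge0.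
move=> rho m t u /andP[r0 r1] tr m1 um.
have hE s : (Gat s).[u] = \sum_(i < size G) (G`_i).[s] * u ^+ i.
  rewrite (@horner_coef_wide _ (size G)) ?size_poly //.
  by apply: eq_bigr => i _; rewrite coef_map.
rewrite !hE -sumrB (le_trans (normc_sum _ _ _)) // mulr_sumr mulr_suml.
apply: ler_sum => i _; rewrite -mulrBl normcM.
apply: ler_pM; rewrite ?normc_ge0 //.
  have -> : (G`_i).[t] - (G`_i).[0] = (G`_i - ((G`_i).[0])%:P).[t].
    by rewrite hornerD hornerN hornerC.
  apply: le_trans (wnorm_horner r0 _ tr) _.
  by apply: wnorm_root0; rewrite ?r0 // hornerD hornerN hornerC subrr.
rewrite normcX; apply: le_trans (_ : m ^+ i <= _).
  by rewrite lerXn2r ?nnegrE ?normc_ge0 //; lra.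
by rewrite ler_weXn2l //; case: i => i; case: (size G).
Qed.

(** If [u] is at distance at least [e] from all the [c] in [cs], then [max (1,
    |u|) ^ k <= K ^ k * prod |u - c|], where [k] is the size of [cs], and the
    product is [|G (0, u)| / |a|].  But [G (0, u) = G (0, u) - G (t, u)] is at
    most [rho B max (1, |u|) ^ k], which is absurd for small [rho].  Both
    sides grow with the same power of [max (1, |u|)], so that large [u] are
    excluded together with those far from [cs]. *)
Lemma root_near_root (a : C) (cs : seq C) (e : R) : a != 0 ->
  Gat 0 = a *: \prod_(c <- cs) ('X - c%:P) -> ((size G).-1 <= size cs)%N -> 0 < e ->
  exists2 rho : R, 0 < rho & forall t u, normc t <= rho -> (Gat t).[u] = 0 ->
    exists2 c, c \in cs & normc (u - c) < e.
Proof.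
move=> a0 G0 szG e0; have [B B0 hB] := horner_drift.
pose S := \sum_(c <- cs) normc c.
have hS c : c \in cs -> normc c <= S.
  move=> ccs; rewrite /S (perm_big _ (perm_to_rem ccs)) big_cons lerDl.
  by apply: sumr_ge0 => i _; apply: normc_ge0.
have S0 : 0 <= S by apply: sumr_ge0 => i _; apply: normc_ge0.
pose d := Num.min e 1.
have d0 : 0 < d by rewrite lt_min e0 ltr01.
have de : d <= e by rewrite ge_min lexx.
have d1 : d <= 1 by rewrite ge_min lexx orbT.
pose K := (1 + S) / d.
have Kd : K * d = 1 + S by rewrite mulfVK // gt_eqF.
have K0 : 0 < K by rewrite divr_gt0 //; lra.
(* With [rho * L < |a|] the two estimates of [max (1, |u|) ^ k] contradict
   each other; [B + 1] replaces [B] to make [L] positive. *)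
pose L := K ^+ size cs * (B + 1).
have L0 : 0 < L by rewrite mulr_gt0 ?exprn_gt0 //; lra.
have na : 0 < normc a by rewrite normc_gt0.
pose rho := Num.min 1 (normc a / (2 * L)).
have rho0 : 0 < rho by rewrite lt_min ltr01 divr_gt0 //; lra.
have rhoL : rho * L <= normc a / 2.
  have : rho <= normc a / (2 * L) by rewrite ge_min lexx orbT.
  rewrite ler_pdivlMr; [lra|lra].
exists rho => // t u tr Gu.
have [/hasP[c ccs hc]|/hasPn far] := boolP (has (fun c => normc (u - c) < e) cs).
  by exists c.
pose m := Num.max 1 (normc u).
have m1 : 1 <= m by rewrite le_max lexx.
have um : normc u <= m by rewrite le_max lexx orbT.
have hfar c : c \in cs -> m <= K * normc (u - c).
  move=> ccs; have := far c ccs; rewrite -leNgt => ec.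
  apply: (far_bound d0 d1 S0 Kd (le_trans de ec) _ (hS _ ccs)).
  by rewrite -{1}(subrK c u) le_normcD.
have hprod : m ^+ size cs <= K ^+ size cs * normc (\prod_(c <- cs) (u - c)).
  move: hfar; elim: (cs) => [|c s IH] hf.
    by rewrite big_nil normc1 !expr0 mulr1.
  rewrite big_cons normcM /= !exprS mulrACA.
  rewrite ler_pM ?exprn_ge0 //; [lra|lra| |].
    by apply: hf; rewrite mem_head.
  by apply: IH => c' c's; apply: hf; rewrite in_cons c's orbT.
have r1 : rho <= 1 by rewrite ge_min lexx.
have := hB rho m t u; rewrite ltW // r1 => /(_ isT tr m1 um).
rewrite Gu sub0r normcN G0 hornerZ horner_prod normcM.
under eq_bigr do rewrite hornerXsubC.
move=> hle.
have hm : m ^+ (size G).-1 <= m ^+ size cs by rewrite ler_weXn2l.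
set P := normc (\prod_(_ <- _) _) in hle hprod.
have mk0 : 0 < m ^+ size cs by rewrite exprn_gt0 // (lt_le_trans ltr01).
have Kk0 : 0 < K ^+ size cs by rewrite exprn_gt0.
have e1 : normc a * m ^+ size cs <= rho * L * m ^+ size cs.
  apply: le_trans (_ : normc a * (K ^+ size cs * P) <= _).
    by rewrite ler_wpM2l // ltW.
  rewrite mulrCA; apply: le_trans (_ : K ^+ size cs * (rho * B * m ^+ size cs) <= _).
    rewrite ler_wpM2l ?(ltW Kk0) // (le_trans hle) // ler_wpM2l // mulr_ge0 //.
    exact: ltW.
  have -> : rho * L * m ^+ size cs = K ^+ size cs * (rho * B * m ^+ size cs) +
     rho * K ^+ size cs * m ^+ size cs by rewrite /L; ring.
  by rewrite lerDl !mulr_ge0 // ltW.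
by move: e1; rewrite ler_pM2r // => e1; case: (half_lt_absurd na e1 rhoL).
Qed.

Lemma simple_root_prod (F : fieldType) (a c : F) (cs : seq F) : a != 0 -> uniq cs -> c \in cs ->
  (a *: \prod_(c <- cs) ('X - c%:P))^`().[c] != 0.
Proof.
move=> a0 ucs ccs; rewrite (perm_big _ (perm_to_rem ccs)) big_cons.
rewrite derivZ derivM derivXsubC mul1r hornerZ hornerD [in X in _ + X]hornerM.
rewrite hornerXsubC subrr mul0r addr0 mulf_neq0 //.
rewrite -[_ != 0]/(~~ root _ c) root_prod_XsubC mem_rem_uniq //.
by rewrite !inE eqxx.
Qed.

(** One step of Newton's method with frozen derivative, [v - G (t, c + v) /
    al], has the solutions [v = u - c] as fixed points, and its constant and
    linear coefficients vanish at [t = 0]. *)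
Lemma simple_root_series (c : C) : (Gat 0).[c] = 0 -> (Gat 0)^`().[c] != 0 ->
  exists (m : nat -> C) (rho K d : R),
  [/\ 0 < rho, 0 < d, 0 < K & m 0%N = 0] /\
  [/\ forall n, normc (m n) * rho ^+ n <= K &
   forall t u : C, normc t <= rho / 2 -> normc (u - c) <= d ->
     (Gat t).[u] = 0 ->
   forall N, normc (u - c - \sum_(n < N.+1) m n * t ^+ n) <= K / 2 ^+ N ].
Proof.
set al := ((Gat 0)^`()).[c] => Gc al0.
pose H : {poly {poly C}} := 'X - (al^-1)%:P *: (G \Po ('X + (c%:P)%:P)).
have evE (F : {poly {poly C}}) (t x : C) : (F.[x%:P]).[t] = (map_poly (horner_eval t) F).[x].
  rewrite -[(F.[x%:P]).[t]]/(horner_eval t (F.[x%:P])) -horner_map.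
  congr (_.[_]); exact: hornerC.
have H0 : (H`_0).[0] = 0.
  rewrite -horner_coef0 hornerD hornerX add0r hornerN hornerZ hornerN hornerM.
  by rewrite horner_comp hornerD hornerX !hornerC add0r evE Gc mulr0 oppr0.
have H1 : (H`_1).[0] = 0.
  rewrite -[H`_1]mulr1n -coef_deriv -horner_coef0.
  rewrite derivB derivX derivZ deriv_comp derivD derivX derivC addr0 mulr1.
  rewrite !(hornerD, hornerC, hornerN, hornerZ, horner_comp, hornerX, hornerM) add0r.
  by rewrite evE -deriv_map mulVf ?subrr.
have [rho [K [d [rho0 d0 K0 hm hfix]]]] := fixed_point_series H0 H1.
exists (picard_coef H), rho, K, d; split.
  by split=> //; rewrite /picard_coef /= coef0.
split => // t u tr ud Gu; apply: hfix => //.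
rewrite rmorphB /= map_polyX map_polyZ /= map_comp_poly rmorphD /= map_polyX !map_polyC /=.
rewrite /horner_eval !hornerC hornerD hornerX hornerN hornerZ horner_comp hornerD hornerX hornerC.
by rewrite subrK Gu mulr0 subr0.
Qed.

End Perturbation.

(** * Following a root near infinity *)

Lemma lt_segment (R : realFieldType) (M x y s : R) :
  0 <= s <= 1 -> M < x -> M < y -> M < x + s * (y - x).
Proof.
move=> /andP[s0 s1] Mx My; have [xy|yx] := lerP x y.
  by rewrite (lt_le_trans Mx) // lerDl mulr_ge0 // subr_ge0.
by rewrite (lt_le_trans My) // -subr_ge0 (_ : _ - y = (1 - s) * (x - y)); [rewrite mulr_ge0 ?subr_ge0 // ltW|ring].
Qed.

Section Topology.
Local Open Scope classical_set_scope.
Variable R : realType.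
Local Notation C := R[i].

Lemma near_inftyP (P : C -> Prop) :
  near_infty P <-> exists2 M : R, 0 < M & forall z, M < normc z -> P z.
Proof.
split=> [[M hM]|[M M0 hM]].
  exists (Num.max 1 M) => [|z]; first by rewrite lt_max ltr01.
  by rewrite gt_max => /andP[_ h]; apply: hM; rewrite normr_normc ltcR.
by exists M => z; rewrite normr_normc ltcR => /hM.
Qed.

Lemma near_infty_and (P Q : C -> Prop) : near_infty P -> near_infty Q ->
  near_infty (fun z => P z /\ Q z).
Proof.
move=> [M hM] [M' hM']; exists (Num.max M M') => z.
rewrite normr_normc ltcR gt_max => /andP[h h'].
by split; [apply: hM|apply: hM']; rewrite normr_normc ltcR.
Qed.

Lemma near_infty_mono (P Q : C -> Prop) : (forall z, P z -> Q z) -> near_infty P ->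
  near_infty Q.
Proof. by move=> PQ [M hM]; exists M => z /hM/PQ. Qed.

Lemma near_infty_inv (e : R) : 0 < e -> near_infty (fun z : C => z != 0 /\ normc z^-1 <= e).
Proof.
move=> e0; apply/near_inftyP; exists e^-1 => [|z ez]; first by rewrite invr_gt0.
have z0 : 0 < normc z by rewrite (lt_trans _ ez) ?invr_gt0.
split; first by rewrite -normc_gt0.
by rewrite normcV invf_ple ?posrE // ltW.
Qed.

Lemma continuous_dist_line (u : C^o -> C^o) (a b c : C) (s : R) :
  {for a + s%:C * b, continuous u} ->
  {for s, continuous (fun r : R => normc (u (a + r%:C * b) - c))}.
Proof.
move=> cu.
have hl : (fun r : R => (a + r%:C * b : C^o)) @ s --> (a + s%:C * b : C^o).
  apply/cvgrPdist_lt => e e0.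
  have [e' e'E] : exists e' : R, e = e'%:C.
    by move: e0; case: e => x y /=; rewrite ltcE /= => /andP[/eqP -> _]; exists x.
  subst e; rewrite ltcR in e0.
  have B0 : 0 < normc b + 1 by rewrite ltr_wpDl ?normc_ge0.
  near=> r.
  have -> : a + s%:C * b - (a + r%:C * b) = (s - r)%:C * b by rewrite rmorphB /=; ring.
  rewrite normr_normc ltcR normcM normc_real.
  apply: le_lt_trans (_ : `|s - r| * (normc b + 1) < _).
    by rewrite ler_wpM2l // lerDl.
  rewrite -ltr_pdivlMr //.
  by near: r; apply: cvgr_dist_lt => //; rewrite divr_gt0.
have hc : (fun r : R => u (a + r%:C * b)) @ s --> u (a + s%:C * b).
  exact: cvg_comp hl cu.
apply/cvgrPdist_lt => e e0.
have e0' : (0 : C) < e%:C by rewrite ltcR.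
move/cvgrPdist_lt: hc => /(_ _ e0') hn.
near=> r.
have h : normc (u (a + s%:C * b) - u (a + r%:C * b)) < e.
  by rewrite -ltcR -normr_normc; near: r; exact: hn.
apply: le_lt_trans h.
rewrite ler_norml; apply/andP; split.
  rewrite lerNl opprB lerBlDl.
  have -> : u (a + r%:C * b) - c = (u (a + s%:C * b) - c) - (u (a + s%:C * b) - u (a + r%:C * b)) by ring.
  exact: normcB.
rewrite lerBlDl.
have -> : u (a + s%:C * b) - c = (u (a + r%:C * b) - c) + (u (a + s%:C * b) - u (a + r%:C * b)) by ring.
exact: le_normcD.
Unshelve. all: by end_near.
Qed.

Variables (u : C -> C) (cs : seq C) (e M : R).
Hypotheses (e0 : 0 < e) (M0 : 0 < M)
  (sep : forall c c', c \in cs -> c' \in cs -> normc (c - c') < 4 * e -> c = c')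
  (ucont : forall z, M < normc z -> {for z, continuous (u : C^o -> C^o)})
  (unear : forall z, M < normc z -> exists2 c, c \in cs & normc (u z - c) < e).

(** On the segment the distance of [u] to [c] is continuous and cannot take
    the value [2 e]: it is smaller than [e] when [c] is the root close to [u],
    and at least [3 e] when another root is, by [sep]. *)
Lemma near_root_segment (a b c : C) : c \in cs ->
  (forall s : R, 0 <= s <= 1 -> M < normc (a + s%:C * (b - a))) ->
  normc (u a - c) < e -> normc (u b - c) < e.
Proof.
move=> ccs hM ua.
pose f (r : R) := normc (u (a + r%:C * (b - a)) - c).
have fa : f 0 = normc (u a - c) by rewrite /f rmorph0 mul0r addr0.
have fb : f 1 = normc (u b - c) by rewrite /f rmorph1 mul1r [a + _]addrC subrK.
have fM s : 0 <= s <= 1 -> f s < e \/ 3 * e <= f s.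
  move=> s01; have [c' c's hc'] := unear (hM _ s01).
  have [cc|cc] := eqVneq c c'; first by left; rewrite /f cc.
  right; rewrite leNgt; apply/negP => fs; move/eqP: cc; apply; apply: sep => //.
  have -> : c - c' = (u (a + s%:C * (b - a)) - c') - (u (a + s%:C * (b - a)) - c) by ring.
  apply: le_lt_trans (normcB _ _) _.
  have -> : 4 * e = e + 3 * e by ring.
  exact: ltrD.
rewrite -fb; have h01 : 0 <= (1 : R) <= 1 by rewrite ler01 lexx.
have [//|h3] := fM 1 h01; exfalso.
have fc : {within `[0, 1], continuous f}.
  apply: continuous_in_subspaceT => s; rewrite inE /= in_itv /= => s01.
  apply: continuous_dist_line; apply: ucont; exact: hM.
have [|s s01 fs] := @IVT R f 0 1 (2 * e) ler01 fc.
  rewrite fa; apply/andP; split.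
    by rewrite ge_min; apply/orP; left; apply: ltW; apply: lt_le_trans ua _; rewrite ler_peMl ?ler1n // ltW.
  by rewrite le_max; apply/orP; right; apply: le_trans h3; rewrite ler_wpM2r ?ler_nat // ltW.
move: s01; rewrite in_itv /= => /fM; rewrite fs => -[].
  by rewrite ltNge ler_peMl ?ler1n // ltW.
by rewrite leNgt ltr_pM2r // ltr_nat.
Qed.

Lemma near_root_halfplane (phi : C -> R) (a b c : C) :
  (forall z, phi z <= normc z) ->
  (forall s : R, phi (a + s%:C * (b - a)) = phi a + s * (phi b - phi a)) ->
  M < phi a -> M < phi b -> c \in cs ->
  normc (u a - c) < e -> normc (u b - c) < e.
Proof.
move=> phile philin Ma Mb ccs; apply: near_root_segment => // s s01.
apply: lt_le_trans (phile _); rewrite philin; exact: lt_segment.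
Qed.

(** The half-planes [Re z > M], [Im z > M], [- Re z > M] and [- Im z > M]
    avoid the disc of radius [M], cover the complement of the disc of radius
    [2 M], and are joined through the corners [z0] and [z1] of a square of
    half-side [2 M]. *)
Lemma near_root_exterior : exists2 c, c \in cs &
  forall z, 2 * M < normc z -> normc (u z - c) < e.
Proof.
have M2 : M < 2 * M by rewrite ltr_pMl // ltr1n.
have NM2 : M < - - (2 * M) by rewrite opprK.
have reP (a b : C) (s : R) : complex.Re (a + s%:C * (b - a)) = complex.Re a + s * (complex.Re b - complex.Re a).
  by case: a b => [a1 a2] [b1 b2] /=; rewrite mul0r subr0.
have imP (a b : C) (s : R) : complex.Im (a + s%:C * (b - a)) = complex.Im a + s * (complex.Im b - complex.Im a).
  by case: a b => [a1 a2] [b1 b2] /=; rewrite mul0r addr0.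
have nreP (a b : C) (s : R) : - complex.Re (a + s%:C * (b - a)) = - complex.Re a + s * (- complex.Re b - - complex.Re a).
  by rewrite reP; ring.
have nimP (a b : C) (s : R) : - complex.Im (a + s%:C * (b - a)) = - complex.Im a + s * (- complex.Im b - - complex.Im a).
  by rewrite imP; ring.
have re_le (z : C) : complex.Re z <= normc z := le_trans (ler_norm _) (normc_ge_normRe z).
have im_le (z : C) : complex.Im z <= normc z := le_trans (ler_norm _) (normc_ge_normIm z).
have nre_le (z : C) : - complex.Re z <= normc z.
  by apply: le_trans (ler_norm _) _; rewrite normrN normc_ge_normRe.
have nim_le (z : C) : - complex.Im z <= normc z.
  by apply: le_trans (ler_norm _) _; rewrite normrN normc_ge_normIm.
pose z0 : C := (2 * M) +i* (2 * M).
have [c ccs hc] : exists2 c, c \in cs & normc (u z0 - c) < e.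
  by apply: unear; apply: lt_le_trans (re_le _).
exists c => // z Mz.
have [Rz|Rz] := ltP M (complex.Re z).
  exact: (near_root_halfplane re_le (reP z0 z) M2 Rz ccs).
have [Iz|Iz] := ltP M (complex.Im z).
  exact: (near_root_halfplane im_le (imP z0 z) M2 Iz ccs).
have [Rz'|Rz'] := ltP M (- complex.Re z).
  pose z1 : C := (- (2 * M)) +i* (2 * M).
  apply: (near_root_halfplane nre_le (nreP z1 z) NM2 Rz' ccs).
  exact: (near_root_halfplane im_le (imP z0 z1) M2 M2 ccs).
have [Iz'|Iz'] := ltP M (- complex.Im z).
  pose z1 : C := (2 * M) +i* (- (2 * M)).
  apply: (near_root_halfplane nim_le (nimP z1 z) NM2 Iz' ccs).
  exact: (near_root_halfplane re_le (reP z0 z1) M2 M2 ccs).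
exfalso; move: Mz; rewrite ltNge => /negP; apply.
have -> : z = (complex.Re z)%:C + 'i * (complex.Im z)%:C by rewrite -complexE.
apply: le_trans (le_normcD _ _) _.
rewrite normcM !normc_real.
have -> : normc ('i : C) = 1 by rewrite /= expr0n add0r expr1n sqrtr1.
have -> : 2 * M = M + M by ring.
by rewrite mul1r lerD // ler_norml ?Rz ?Iz lerNl ?Rz' ?Iz'.
Qed.

End Topology.

(** * Expansion of a branch at infinity *)

Lemma coef_sumZXn (A : nzRingType) n (F : 'I_n -> A) (i : 'I_n) :
  (\sum_(j < n) F j *: 'X^j)`_i = F i.
Proof.
rewrite coef_sum (bigD1 i) //= coefZ coefXn eqxx mulr1 big1 ?addr0 // => j ji.
by rewrite coefZ coefXn eq_sym (inj_eq val_inj) (negbTE ji) mulr0.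
Qed.

Lemma size_sumZXn (A : nzRingType) n (F : 'I_n -> A) :
  (size (\sum_(j < n) F j *: 'X^j)%R <= n)%N.
Proof.
apply: (leq_trans (size_sum _ _ _)); apply/bigmax_leqP => j _.
by apply: leq_trans (size_scale_leq _ _) _; rewrite size_polyXn.
Qed.

Lemma finite_lower_bound (R : realFieldType) (s : seq R) :
  exists2 e : R, 0 < e & forall x, x \in s -> 0 < x -> e <= x.
Proof.
elim: s => [|y s [e e0 he]]; first by exists 1.
have [y0|y0] := ltP 0 y.
  exists (Num.min e y) => [|x]; first by rewrite lt_min e0.
  rewrite inE => /orP[/eqP->|xs] x0; first by rewrite ge_min lexx orbT.
  by rewrite ge_min he.
exists e => // x; rewrite inE => /orP[/eqP->|/he//]; by rewrite ltNge y0.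
Qed.

Section Branch.
Local Open Scope classical_set_scope.
Variables (R : realType) (k : nat) (Q : 'I_k.+1 -> {poly R[i]}).
Local Notation C := R[i].
Hypothesis hQ : general_type Q.

(** [t ^ i * Q_i (1 / t)] as a polynomial in [t]; its constant term is the
    coefficient of degree [i] of [Q_i]. *)
Definition rev_coef (i : 'I_k.+1) : {poly C} := \poly_(j < i.+1) (Q i)`_(i - j).
Definition curve_at_infty : {poly {poly C}} := \sum_(i < k.+1) rev_coef i *: 'X^i.
Local Notation G := curve_at_infty.
Local Notation Gat t := (map_poly (horner_eval t) G).

Lemma curve_at_inftyE t u : (Gat t).[u] = \sum_(i < k.+1) (rev_coef i).[t] * u ^+ i.
Proof.
rewrite rmorph_sum /= horner_sum; apply: eq_bigr => i _.
by rewrite map_polyZ /= map_polyXn hornerZ hornerXn.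
Qed.

Lemma curve_substitution z w : z != 0 ->
  \sum_(i < k.+1) (Q i).[z] * w ^+ i = (Gat z^-1).[z * w].
Proof.
move=> z0; rewrite curve_at_inftyE; apply: eq_bigr => i _.
case: hQ => szQ _ _ _.
rewrite exprMn mulrA; congr (_ * _).
rewrite (horner_coef_wide _ (szQ i)) horner_poly mulr_suml.
rewrite (reindex_inj rev_ord_inj) /=; apply: eq_bigr => j _.
rewrite subSS -mulrA; congr (_ * _).
by rewrite exprVn mulrC -expfB_cond ?leq_ord // (negbTE z0) add0n leq_ord.
Qed.

(** [G (0, .)] is the characteristic polynomial with the order of its
    coefficients reversed, so its roots are the inverses of those of the
    latter, which are nonzero since [deg Q_k = k]. *)
Lemma char_factorization : exists (a : C) (cs : seq C),
  [/\ a != 0, uniq cs, size cs = k, forall c, c \in cs -> c != 0 &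
   Gat 0 = a *: \prod_(c <- cs) ('X - c%:P)].
Proof.
case: hQ => szQ szk [s [us szs /allP rs]] _.
have ak : (Q ord_max)`_k != 0.
  have := lead_coef_eq0 (Q ord_max); rewrite lead_coefE szk /= => ->.
  by rewrite -size_poly_gt0 szk.
have s0 x : x \in s -> x != 0.
  move=> xs; apply/eqP => x0; move/rootP: (rs _ xs); rewrite x0 horner_coef0.
  rewrite coef_sum (bigD1 ord_max) //= subnn coefZ coefXn mulr1 big1 ?addr0.
    by move/eqP; rewrite (negbTE ak).
  move=> i ik; rewrite coefZ coefXn eq_sym subn_eq0 leqNgt.
  have -> : (i < k)%N by rewrite ltn_neqAle -ltnS ltn_ord andbT.
  by rewrite mulr0.
have Ginfty : Gat 0 = \sum_(i < k.+1) (Q i)`_i *: 'X^i.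
  rewrite rmorph_sum /=; apply: eq_bigr => i _.
  rewrite map_polyZ /= map_polyXn; congr (_ *: _).
  by rewrite /horner_eval horner_coef0 coef_poly /= subn0.
have cG : (Gat 0)`_k = (Q ord_max)`_k.
  by rewrite Ginfty (coef_sumZXn (fun i : 'I_k.+1 => (Q i)`_i) ord_max).
have szG : size (Gat 0) = k.+1.
  apply/eqP; rewrite eqn_leq {1}Ginfty size_sumZXn /=.
  by rewrite ltnNge; apply/negP => /leq_sizeP/(_ k (leqnn k)); rewrite cG => /eqP; apply/negP.
exists (Q ord_max)`_k, (map GRing.inv s); split => //.
- by rewrite map_inj_uniq //; apply: invr_inj.
- by rewrite size_map.
- by move=> c /mapP[x xs ->]; rewrite invr_eq0 s0.
have rG : all (root (Gat 0)) (map GRing.inv s).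
  apply/allP => c /mapP[x xs ->]; have x0 := s0 _ xs; apply/rootP.
  move/rootP: (rs _ xs); rewrite Ginfty !horner_sum => h.
  apply: (mulfI (expf_neq0 k x0)); rewrite mulr0 -[RHS]h mulr_sumr.
  apply: eq_bigr => i _; rewrite !hornerZ !hornerXn mulrCA; congr (_ * _).
  by rewrite exprVn -expfB_cond // (negbTE x0) add0n -ltnS.
rewrite {1}(all_roots_prod_XsubC _ rG) ?size_map ?szs ?szG //; last first.
  by rewrite uniq_rootsE map_inj_uniq //; apply: invr_inj.
by rewrite lead_coefE szG /= cG.
Qed.

(** Closeness to a single root [c] is first obtained for one distance [e], by
    connectedness.  For smaller distances, needed to enter the ball where the
    power series solution is unique, [u] is close to some root [c'], and [c' =
    c] because the roots are far apart compared to [e]. *)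
Lemma branch_expansion (w : C -> C) : branch_near_infty Q w ->
  exists (c : C) (m : nat -> C) (rho K : R),
  [/\ c != 0, m 0%N = 0, 0 < rho & forall n, normc (m n) * rho ^+ n <= K] /\
  near_infty (fun z => forall N,
    normc (z * w z - c - \sum_(n < N.+1) m n * z^-1 ^+ n) <= K / 2 ^+ N).
Proof.
move=> hw; have [a [cs [a0 ucs szcs cs0 G0]]] := char_factorization.
have szG : ((size G).-1 <= size cs)%N.
  by rewrite szcs; have := size_sumZXn rev_coef; rewrite -/G; case: (size G).
pose u z := z * w z.
have near_root e : 0 < e -> near_infty (fun z => exists2 c, c \in cs & normc (u z - c) < e).
  move=> e0; have [rho rho0 hrho] := root_near_root a0 G0 szG e0.
  apply: near_infty_mono (near_infty_and hw (near_infty_inv rho0)) => z [[_ wz] [z0 zr]].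
  by apply: (hrho z^-1) => //; rewrite -curve_substitution.
have [e e0 sep] : exists2 e : R, 0 < e & forall c c', c \in cs -> c' \in cs ->
    normc (c - c') < 4 * e -> c = c'.
  have [d d0 hd] := finite_lower_bound [seq normc (c - c') | c <- cs, c' <- cs].
  exists (d / 4) => [|c c' ccs c'cs]; first by rewrite divr_gt0.
  rewrite mulrCA divff ?mulr1 ?pnatr_eq0 // => cc'.
  apply/eqP; rewrite -subr_eq0 -normc_eq0; apply/eqP/le_anti; rewrite normc_ge0 andbT.
  by rewrite leNgt; apply/negP => /(hd _ (allpairs_f _ ccs c'cs)); rewrite leNgt cc'.
have [M M0 hM] := (near_inftyP _).1 (near_infty_and hw (near_root e e0)).
have ucont z : M < normc z -> {for z, continuous (u : C^o -> C^o)}.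
  move=> /hM[[dw _] _]; have cw : {for z, continuous (w : C^o -> C^o)}.
    by apply: differentiable_continuous; apply/derivable1_diffP.
  have cz : {for z, continuous (@idfun C^o)} by exact: cvg_id.
  exact: (cvgM cz cw).
have unear z : M < normc z -> exists2 c, c \in cs & normc (u z - c) < e by case/hM.
have [c ccs hc] := near_root_exterior e0 M0 sep ucont unear.
have Gc : (Gat 0).[c] = 0.
  by apply/rootP; rewrite G0 rootZ // root_prod_XsubC.
have Gc' : ((Gat 0)^`()).[c] != 0 by rewrite G0 simple_root_prod.
have [m [rho [K [d [[rho0 d0 K0 m0] [hm hser]]]]]] := simple_root_series Gc Gc'.
exists c, m, rho, K; split; first by split=> //; apply: cs0.
pose d' := Num.min d e.
have d'0 : 0 < d' by rewrite lt_min d0.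
have rho2 : 0 < rho / 2 by rewrite divr_gt0.
have near_c : near_infty (fun z => normc (u z - c) < e).
  by apply/near_inftyP; exists (2 * M) => //; rewrite mulr_gt0.
apply: near_infty_mono (near_infty_and hw (near_infty_and near_c
  (near_infty_and (near_root _ d'0) (near_infty_inv rho2)))).
move=> z [[_ wz] [zc [[c' c'cs zc'] [z0 zr]]]] N.
apply: hser => //; last by rewrite -curve_substitution.
have -> : c = c'.
  apply: sep => //.
  have -> : c - c' = (u z - c') - (u z - c) by ring.
  apply: le_lt_trans (normcB _ _) _.
  have zc'e : normc (u z - c') < e by apply: lt_le_trans zc' _; rewrite ge_min lexx orbT.
  apply: lt_trans (ltrD zc'e zc) _.
  have -> : 4 * e = e + e + 2 * e by ring.
  by rewrite ltrDl mulr_gt0.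
by apply: ltW; apply: lt_le_trans zc' _; rewrite ge_min lexx.
Qed.

End Branch.

(** * Weights of the mixture *)

Lemma sqr_mul4X_le k : (0 < k)%N -> (k ^ 2 * 4 ^ k.+1 <= 16 ^ k)%N.
Proof.
move=> k0; rewrite -[16%N]/(4 * 4)%N expnMn [(4 ^ k.+1)%N]expnS mulnA leq_mul2r; apply/orP; right.
have -> : (4 ^ k = (2 ^ k) ^ 2)%N by rewrite -expnM mulnC expnM.
have -> : (k ^ 2 * 4 = (k * 2) ^ 2)%N by rewrite expnMn.
rewrite leq_exp2r //.
by case: k k0 => // k _; rewrite expnS mulnC leq_mul2l /= ltn_expl.
Qed.

Section Weights.
Variable R : realFieldType.

(** The weights have to decrease slowly: for a divisor [k] of [n], [weight (n
    / k)] is at most [k ^ 2] times [weight n], a loss compensated by the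
    factor [16 ^- k] of [sum_proper_divisors].  Geometric weights decrease too
    fast for such an estimate. *)
Definition weight (n : nat) : R := ((n * n.+1)%:R)^-1.

Lemma weight_ge0 n : 0 <= weight n.
Proof. by rewrite invr_ge0. Qed.

Lemma weight_gt0 n : (0 < n)%N -> 0 < weight n.
Proof. by move=> n0; rewrite invr_gt0 ltr0n muln_gt0 n0. Qed.

Lemma sum_weight N : \sum_(1 <= d < N.+1) weight d = 1 - N.+1%:R^-1.
Proof.
elim: N => [|N IH]; first by rewrite big_geq // invr1 subrr.
rewrite big_nat_recr //= IH /weight natrM.
have h1 : N.+1%:R != 0 :> R by rewrite pnatr_eq0.
have h2 : N.+2%:R != 0 :> R by rewrite pnatr_eq0.
have h3 : N.+2%:R = N.+1%:R + 1 :> R by rewrite -natr1.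
by rewrite h3 in h2 *; field; rewrite [1 + N%:R]addrC natr1 h1 h2.
Qed.

Lemma weight_divisor k d : (0 < k)%N -> (0 < d)%N ->
  weight d <= (k ^ 2)%:R * weight (k * d).
Proof.
move=> k0 d0; rewrite ler_pdivlMr ?ltr0n ?muln_gt0 ?k0 ?d0 //.
rewrite mulrC ler_pdivrMr ?ltr0n ?muln_gt0 ?d0 // -natrM ler_nat.
rewrite expnS expn1 -!mulnA leq_mul2l; apply/orP; right.
rewrite mulnCA leq_mul2l; apply/orP; right.
by rewrite mulnS addnC -addn1 leq_add2l.
Qed.

Lemma sum_geometric n :
  \sum_(2 <= k < n.+2) (4 ^- k.+1 : R) = 48^-1 - 4 ^- n.+2 / 3.
Proof.
elim: n => [|n IH].
  by rewrite big_geq // expr2; field.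
rewrite big_nat_recr //= IH [4 ^+ n.+3]exprS.
have : 4 ^+ n.+2 != 0 :> R by rewrite expf_neq0 // pnatr_eq0.
by move=> h; field.
Qed.

(** The quotients [k = n / d] are distinct integers larger than 1, and each
    contributes at most [weight n * k ^ 2 * 16 ^- k <= weight n * 4 ^- k.+1].
    The sum of [4 ^- k.+1] over [k >= 2] is [1 / 48]. *)
Lemma sum_proper_divisors (n : nat) : (0 < n)%N ->
  \sum_(1 <= d < n | (d %| n)%N) weight d * (16 ^- (n %/ d)%N) <= weight n / 32.
Proof.
move=> n0.
(* The sum over divisors is compared with a sum over all [k], reached by the
   injective map [d |-> n / d]. *)
pose f (k : nat) : R := if (1 < k)%N then 4 ^- k.+1 else 0.
have f0 k : 0 <= f k by rewrite /f; case: ifP => // _; rewrite invr_ge0 exprn_ge0.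
have step1 d : (1 <= d < n)%N -> (d %| n)%N ->
    weight d * (16 ^- (n %/ d)%N) <= weight n * f (n %/ d)%N.
  move=> /andP[d0 dn] dvd; have [k nE] := dvdnP dvd; subst n.
  rewrite mulnK //.
  have k1 : (1 < k)%N by move: dn; rewrite -{1}(mul1n d) ltn_pmul2r.
  rewrite /f k1; apply: le_trans (_ : (k ^ 2)%:R * weight (k * d) * 16 ^- k <= _).
    by rewrite ler_wpM2r ?weight_divisor // ?invr_ge0 ?exprn_ge0 // ltnW.
  rewrite mulrAC mulrC ler_wpM2l ?weight_ge0 //.
  rewrite ler_pdivrMr ?exprn_gt0 // mulrC ler_pdivlMr ?exprn_gt0 //.
  by rewrite -!natrX -natrM ler_nat sqr_mul4X_le // ltnW.
apply: le_trans (_ : \sum_(1 <= d < n | (d %| n)%N) weight n * f (n %/ d)%N <= _).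
  rewrite big_nat_cond [leRHS]big_nat_cond; apply: ler_sum => d /andP[dn dvd].
  exact: step1.
rewrite -mulr_sumr ler_wpM2l ?weight_ge0 //.
apply: le_trans (_ : \sum_(k < n.+1) f k <= _).
  rewrite big_geq_mkord.
  have inj : {in [set d : 'I_n | (d %| n)%N && (1 <= d)%N] &, injective (fun d : 'I_n => inord (n %/ d)%N : 'I_n.+1)}.
    move=> x y; rewrite !inE => /andP[dx x0] /andP[dy y0] /(congr1 val) /=.
    rewrite !inordK ?ltnS ?leq_div // => e; apply: val_inj => /=.
    have q0 : (0 < n %/ x)%N by rewrite divn_gt0 // dvdn_leq.
    by apply/eqP; rewrite -(eqn_pmul2l q0) divnK // e divnK.
  rewrite [leLHS](_ : _ = \sum_(d in [set d : 'I_n | (d %| n)%N && (1 <= d)%N]) f (inord (n %/ d)%N : 'I_n.+1)); last first.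
    by apply: eq_big => [d|d _]; rewrite ?inE // inordK // ltnS leq_div.
  rewrite -(big_imset (fun k : 'I_n.+1 => f k) inj) /=.
  by rewrite big_mkcond ler_sum // => k _; case: ifP.
case: n n0 {step1} => // n _.
rewrite -(big_mkord xpredT f) (big_cat_nat _ (n := 2)) //=.
rewrite big_nat_recr //= big_nat1 /f /= !add0r.
rewrite -/f (eq_big_nat _ _ (F2 := fun k => 4 ^- k.+1)); last first.
  by move=> k /andP[k2 _]; rewrite k2.
rewrite sum_geometric.
have : (0 : R) <= 4 ^- n.+2 / 3 by rewrite mulr_ge0 // invr_ge0 ?exprn_ge0.
lra.
Qed.

End Weights.

(** * Atoms with prescribed moments *)

Lemma sum_multiples (V : nmodType) (d N : nat) (F : nat -> V) : (0 < d)%N ->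
  \sum_(0 <= n < N.+1 | (d %| n)%N) F n = \sum_(0 <= j < (N %/ d).+1) F (d * j)%N.
Proof.
move=> d0; elim: N => [|N IH].
  by rewrite div0n !big_mkcond !big_nat1 /= dvdn0 muln0.
rewrite big_mkcond big_nat_recr // -big_mkcond /= IH divnS //.
case: ifP => dN; last by rewrite addr0 add0n.
rewrite add1n [RHS]big_nat_recr //=; congr (_ + F _).
by have := divnK dN; rewrite divnS // dN add1n mulnC => ->.
Qed.

Section Atoms.
Variable R : rcfType.
Local Notation C := R[i].
Local Notation wt := (weight R).
Variable m : nat -> C.

(** A course-of-values recursion, since the [n]-th atom needs all the atoms of
    index a proper divisor of [n]. *)
Fixpoint partial_atoms (N : nat) : nat -> C :=
  if N is N'.+1 then fun n =>
    if n == N then (m n - \sum_(1 <= d < n | (d %| n)%N)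
                      (wt d)%:C * partial_atoms N' d ^+ (n %/ d)) / (wt n)%:C
    else partial_atoms N' n
  else fun=> 0.

Definition atom n := partial_atoms n n.

Lemma partial_atomsE N n : (n <= N)%N -> partial_atoms N n = atom n.
Proof.
move/subnK <-; elim: (N - n)%N => [//|k IH] /=.
by rewrite ifF ?IH // ltn_eqF // ltnS leq_addl.
Qed.

(** The moment of order [n] of the mixture is the prescribed one. *)
Lemma atomE n : (0 < n)%N ->
  \sum_(1 <= d < n.+1 | (d %| n)%N) (wt d)%:C * atom d ^+ (n %/ d) = m n.
Proof.
case: n => // n _.
have w0 : (wt n.+1)%:C != 0 by rewrite fmorph_eq0 gt_eqF // weight_gt0.
rewrite big_mkcond big_nat_recr // -big_mkcond /= dvdnn divnn expr1.
rewrite {2}/atom /= eqxx mulrCA divff // mulr1 addrC.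
apply/eqP; rewrite -[eqbRHS](subrK (\sum_(1 <= d < n.+1 | (d %| n.+1)%N)
   (wt d)%:C * partial_atoms n d ^+ (n.+1 %/ d))); apply/eqP; congr (_ + _).
rewrite big_nat_cond [RHS]big_nat_cond; apply: eq_bigr => d /andP[/andP[_ dn] _].
by rewrite partial_atomsE.
Qed.

Variable B : R.
Hypotheses (B0 : 0 < B)
  (mB : forall n, (0 < n)%N -> normc (m n) <= wt n / 32 * B ^+ n).

(** Half of the bound [weight n * B ^ n / 16] on [weight n * |a_n|] is taken
    by [m_n], and half by the proper divisors.  The factor [1 / 16] in the
    induction hypothesis is essential: raised to the power [n / d >= 2], it
    makes up for the larger weights of the proper divisors. *)
Lemma normc_atom n : (0 < n)%N -> normc (atom n) <= B ^+ n / 16.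
Proof.
elim/ltn_ind: n => n IH n0.
have w0 := weight_gt0 R n0.
have E := atomE n0.
rewrite big_mkcond big_nat_recr //= dvdnn divnn n0 expr1 -big_mkcond /= in E.
have {}E : (wt n)%:C * atom n = m n - \sum_(1 <= d < n | (d %| n)%N) (wt d)%:C * atom d ^+ (n %/ d).
  by rewrite -E addrAC subrr add0r.
rewrite -(ler_pM2l w0).
have <- : normc ((wt n)%:C * atom n) = wt n * normc (atom n).
  by rewrite normcM normc_real ger0_norm // ltW.
rewrite E (le_trans (normcB _ _)) //.
have h : normc (\sum_(1 <= d < n | (d %| n)%N) (wt d)%:C * atom d ^+ (n %/ d)) <=
   wt n / 32 * B ^+ n.
  apply: le_trans (normc_sum _ _ _) _.
  apply: le_trans (_ : (\sum_(1 <= d < n | (d %| n)%N) wt d * (16 ^- (n %/ d)%N)) * B ^+ n <= _).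
    rewrite mulr_suml big_nat_cond [leRHS]big_nat_cond; apply: ler_sum => d /andP[/andP[d0 dn] dvd].
    rewrite normcM normc_real ger0_norm ?weight_ge0 // -mulrA.
    rewrite ler_wpM2l ?weight_ge0 // normcX.
    apply: le_trans (_ : (B ^+ d / 16) ^+ (n %/ d)%N <= _).
      by rewrite lerXn2r ?nnegrE ?normc_ge0 ?divr_ge0 ?exprn_ge0 ?(ltW B0) // IH.
    by rewrite expr_div_n -exprM mulnC divnK // mulrC.
  by rewrite ler_wpM2r ?exprn_ge0 ?(ltW B0) // sum_proper_divisors.
apply: le_trans (lerD (mB n0) h) _.
by rewrite le_eqVlt; apply/orP; left; apply/eqP; field.
Qed.

Lemma geometric_remainder (x : C) J : 1 - x != 0 ->
  (1 - x)^-1 = \sum_(0 <= j < J) x ^+ j + x ^+ J / (1 - x).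
Proof.
move=> x1; apply: (mulIf x1); rewrite mulVf // mulrDl mulfVK //.
rewrite big_mkord; have <- : 1 - x ^+ J = (\sum_(j < J) x ^+ j) * (1 - x).
  rewrite -{1}(expr1n _ J) subrXX mulrC; congr (_ * _).
  by apply: eq_bigr => j _; rewrite expr1n mul1r.
by rewrite subrK.
Qed.

(** Expanding every [1 / (1 - a_d t ^ d)] up to degree [N] and collecting the
    powers of [t], the coefficient of [t ^ n] is [m_n] for [0 < n <= N], and
    for [n = 0] the sum of the first weights, which misses 1 by [1 / (N + 1)].
    The remainders are of size [2 ^- N]. *)
Lemma atoms_approx (t : C) N : normc t * B <= 2^-1 ->
  normc (1 + \sum_(1 <= n < N.+1) m n * t ^+ n
     - \sum_(1 <= d < N.+1) (wt d)%:C / (1 - atom d * t ^+ d)) <= N.+1%:R^-1 + 2 / 2 ^+ N.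
Proof.
move=> tB.
pose x d := atom d * t ^+ d.
have xle d : (0 < d)%N -> normc (x d) <= 2 ^- d.
  move=> d0; rewrite normcM normcX.
  apply: le_trans (_ : B ^+ d * normc t ^+ d <= _).
    rewrite ler_wpM2r ?exprn_ge0 ?normc_ge0 // (le_trans (normc_atom d0)) //.
    by rewrite ler_piMr ?exprn_ge0 ?(ltW B0) // invf_le1 // ler1n.
  by rewrite -exprMn mulrC -exprVn lerXn2r ?nnegrE ?mulr_ge0 ?normc_ge0 ?invr_ge0 ?(ltW B0).
have x1 d : (0 < d)%N -> 2^-1 <= normc (1 - x d).
  move=> d0; have := xle d d0 => h.
  have h2 : normc (x d) <= 2^-1.
    apply: le_trans h _; rewrite -exprVn; case: d d0 => // d _.
    by rewrite exprS ler_piMr ?invr_ge0 // exprn_ile1 ?invr_ge0 // invf_le1 ?ler1n.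
  have := le_normcD (1 - x d) (x d); rewrite subrK normc1.
  by move: h2; set y := normc (x d); set z := normc (1 - _); clear; lra.
have x0 d : (0 < d)%N -> 1 - x d != 0.
  by move=> d0; rewrite -normc_gt0 (lt_le_trans _ (x1 d d0)) ?invr_gt0.
(* The term of index [d] is expanded up to the power [N / d] of [x d], that
   is, up to degree at most [N] in [t]; the remainder has degree larger than
   [N]. *)
pose r d := (wt d)%:C * (x d ^+ (N %/ d).+1 / (1 - x d)).
have main : \sum_(1 <= d < N.+1) (wt d)%:C / (1 - x d) =
   (1 - N.+1%:R^-1)%:C + \sum_(1 <= n < N.+1) m n * t ^+ n + \sum_(1 <= d < N.+1) r d.
  have -> : \sum_(1 <= d < N.+1) (wt d)%:C / (1 - x d) =
    \sum_(1 <= d < N.+1) \sum_(0 <= n < N.+1 | (d %| n)%N) (wt d)%:C * (atom d ^+ (n %/ d) * t ^+ n)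
    + \sum_(1 <= d < N.+1) r d.
    rewrite -big_split /=; apply: eq_big_nat => d /andP[d0 _].
    rewrite (geometric_remainder (N %/ d).+1 (x0 d d0)) mulrDr; congr (_ + _).
    rewrite sum_multiples // mulr_sumr; apply: eq_bigr => j _.
    by rewrite mulKn // /x exprMn exprM.
  congr (_ + _); rewrite (exchange_big_dep xpredT) //= big_ltn //; congr (_ + _).
    rewrite -sum_weight rmorph_sum /=; apply: eq_big => [d|d _]; rewrite ?dvdn0 //.
    by rewrite div0n !expr0 !mulr1.
  apply: eq_big_nat => n /andP[n0 nN].
  rewrite -(atomE n0) mulr_suml.
  rewrite [RHS](big_nat_widen _ _ N.+1) //=; apply: eq_big => [d|d _]; last by rewrite mulrA.
  case dn : (d %| n)%N => //=.
  by rewrite ltnS dvdn_leq.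
rewrite main.
have -> : 1 + \sum_(1 <= n < N.+1) m n * t ^+ n - ((1 - N.+1%:R^-1)%:C +
    \sum_(1 <= n < N.+1) m n * t ^+ n + \sum_(1 <= d < N.+1) r d) =
    (N.+1%:R^-1)%:C - \sum_(1 <= d < N.+1) r d.
  by rewrite rmorphB rmorph1; ring.
rewrite (le_trans (normcB _ _)) // normc_real ger0_norm ?invr_ge0 // lerD2l.
apply: le_trans (normc_sum _ _ _) _.
apply: le_trans (_ : \sum_(1 <= d < N.+1) wt d * (2 / 2 ^+ N) <= _).
  rewrite big_nat [leRHS]big_nat; apply: ler_sum => d /andP[d0 _].
  rewrite normcM normc_real ger0_norm ?weight_ge0 //.
  rewrite ler_wpM2l ?weight_ge0 // normcM normcV mulrC.
  rewrite ler_pM ?invr_ge0 ?normc_ge0 //.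
    by rewrite invf_ple ?posrE ?x1 // (lt_le_trans _ (x1 d d0)) ?invr_gt0.
  rewrite normcX; apply: le_trans (_ : (2 ^- d) ^+ (N %/ d).+1 <= _).
    by rewrite lerXn2r ?nnegrE ?normc_ge0 ?invr_ge0 ?exprn_ge0 // xle.
  rewrite exprVn -exprM lef_pV2 ?posrE ?exprn_gt0 // ler_eXn2l ?ltr1n //.
  by rewrite mulnC ltnW // ltn_ceil.
by rewrite -mulr_suml sum_weight ler_piMl ?divr_ge0 ?exprn_ge0 // lerBlDr lerDl invr_ge0.
Qed.

End Atoms.

(** * Topology and measurability in the plane *)

Local Open Scope classical_set_scope.

Section PlaneTopology.
Variable R : realType.
Local Notation C := R[i].

Lemma lipschitz_continuous (f : C -> R) :
  (forall x y, `|f x - f y| <= normc (x - y)) -> continuous (f : C^o -> R).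
Proof.
move=> hf x; apply/(@cvgrPdist_lt _ _ C^o (nbhs (x : C^o)) _ f (f x)) => e e0.
have e0' : (0 : C) < e%:C by rewrite ltcR.
have hn : \forall y \near (x : C^o), ball (x : C^o) e%:C y by exact: nbhsx_ballx.
rewrite -ball_normE /= in hn.
near=> y; apply: le_lt_trans (hf _ _) _.
by rewrite -ltcR -normr_normc; near: y; exact: hn.
Unshelve. all: by end_near. Qed.

Lemma normc_lipschitz (x y : C) : `|normc x - normc y| <= normc (x - y).
Proof.
rewrite ler_norml lerNl opprB !lerBlDr; apply/andP; split.
  by rewrite -[in leRHS](normcN (x - y)) opprB -{1}(subrK x y) le_normcD.
by rewrite -{1}(subrK y x) le_normcD.
Qed.

(** [R[i]^o] carries no product structure, so that compactness is transported
    from a square of [R * R] by the continuous map [(x, y) |-> x +i* y]. *)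
Lemma compact_disc (B : R) : compact ([set x | normc x <= B] : set C^o).
Proof.
pose f (p : R * R) : C^o := p.1 +i* p.2.
have fE p : f p = p.1%:C + 'i * p.2%:C.
  by case: p => x y; rewrite /f /= [LHS]complexE.
have cf : continuous f.
  move=> p; apply/cvgrPdist_lt => e e0.
  have [e' e'E] : exists e' : R, e = e'%:C.
    by move: e0; case: e => x y /=; rewrite ltcE /= => /andP[/eqP -> _]; exists x.
  subst e; rewrite ltcR in e0.
  have e20 : 0 < e' / 2 by rewrite divr_gt0.
  have /cvgrPdist_lt/(_ _ e20) h1 : (fun p : R * R => p.1) @ p --> p.1 by exact: cvg_fst.
  have /cvgrPdist_lt/(_ _ e20) h2 : (fun p : R * R => p.2) @ p --> p.2 by exact: cvg_snd.
  near=> q.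
  rewrite normr_normc ltcR !fE.
  have -> : p.1%:C + 'i * p.2%:C - (q.1%:C + 'i * q.2%:C) = (p.1 - q.1)%:C + 'i * (p.2 - q.2)%:C.
    by rewrite !rmorphB /=; ring.
  apply: le_lt_trans (le_normcD _ _) _.
  rewrite normcM !normc_real.
  have -> : normc ('i : C) = 1 by rewrite /= expr0n add0r expr1n sqrtr1.
  rewrite mul1r [ltRHS]splitr; apply: ltrD; near: q; [exact: h1|exact: h2].
have cK : compact (f @` (`[- B, B] `*` `[- B, B])).
  apply: continuous_compact; first exact: continuous_subspaceT.
  by apply: compact_setX; apply: segment_compact.
apply: subclosed_compact cK _.
  rewrite (_ : [set x | normc x <= B] = (fun x : C => normc x) @^-1` [set r | r <= B]) //.
  apply: closed_comp; last exact: closed_le.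
  by move=> x _; apply: lipschitz_continuous; exact: normc_lipschitz.
move=> x /= xB; exists (complex.Re x, complex.Im x); last by case: x {xB}.
by split; rewrite /= in_itv /= -ler_norml; apply: le_trans xB;
  [exact: normc_ge_normRe|exact: normc_ge_normIm].
Unshelve. all: by end_near. Qed.

Lemma open_normc_gt (B : R) : open ([set x | B < normc x] : set C^o).
Proof.
rewrite (_ : [set x | B < normc x] = (fun x : C => normc x) @^-1` [set r | B < r]) //.
apply: open_comp; last exact: open_gt.
by move=> y _; apply: lipschitz_continuous; exact: normc_lipschitz.
Qed.

Lemma compact_msupport (mu : probability (borelC R) R) (B : R) :
  mu [set x : C | B < normc x] = 0%E -> compact (msupport mu).
Proof.
move=> mu0; apply: subclosed_compact (compact_disc (B := B)) _.
  rewrite -openC openE => x /= /existsNP[U /not_implyP[oU /not_implyP[Ux muU]]].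
  apply: filterS (open_nbhs_nbhs (conj oU Ux)) => y Uy /(_ U oU Uy).
  exact: muU.
move=> x /= supp; rewrite leNgt; apply/negP => Bx.
have := supp [set x : C | B < normc x]; rewrite mu0 ltxx => h; apply/notF/h => //.
exact: open_normc_gt.
Qed.

Lemma lipschitz_measurable (f : C -> R) :
  (forall x y, `|f x - f y| <= normc (x - y)) ->
  measurable_fun [set: borelC R] (f : borelC R -> R).
Proof.
move=> hf; apply: (measurability _ (RGenOInfty.measurableE R)).
move=> _ [_ [x ->] <-]; rewrite setTI; apply: sub_sigma_algebra.
apply: open_comp; last exact: interval_open.
by move=> y _; apply: lipschitz_continuous.
Qed.

(** The kernel is not continuous at [xi = z].  Its real and imaginary parts
    are a real or imaginary part of [z - xi] times the inverse of a
    nonnegative function, and this inverse is a power with exponent [- 1],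
    which is a measurable function on all of [R]. *)
Lemma measurable_cauchy_kernel (z : C) :
  measurable_fun [set: borelC R] (fun xi : C => complex.Re ((z - xi)^-1)) /\
  measurable_fun [set: borelC R] (fun xi : C => complex.Im ((z - xi)^-1)).
Proof.
have mRe : measurable_fun [set: borelC R] (fun xi : C => complex.Re (z - xi)).
  apply: lipschitz_measurable => x y; rewrite -raddfB /= opprD opprK addrACA subrr add0r.
  by apply: le_trans (normc_ge_normRe _) _; rewrite addrC normc_distC.
have mIm : measurable_fun [set: borelC R] (fun xi : C => complex.Im (z - xi)).
  apply: lipschitz_measurable => x y; rewrite -raddfB /= opprD opprK addrACA subrr add0r.
  by apply: le_trans (normc_ge_normIm _) _; rewrite addrC normc_distC.
pose D (xi : C) := complex.Re (z - xi) ^+ 2 + complex.Im (z - xi) ^+ 2.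
have mD : measurable_fun [set: borelC R] (fun xi : C => D xi `^ (- 1)).
  apply: (measurableT_comp (measurable_powR _)).
  by apply: measurable_funD; apply: measurable_funX.
have DE xi : D xi `^ (- 1) = (D xi)^-1.
  by rewrite powR_inv1 // addr_ge0 // sqr_ge0.
have invE xi : (z - xi)^-1 = (complex.Re (z - xi) * (D xi `^ (- 1))) -i* (complex.Im (z - xi) * D xi `^ (- 1)).
  by rewrite DE /D; case: (z - xi).
split.
  by under eq_fun do rewrite invE /=; apply: measurable_funM.
under eq_fun do rewrite invE /=.
by apply: measurable_funN; apply: measurable_funM.
Qed.

End PlaneTopology.

(** * Discrete probability measures *)

Section AtomicMeasure.
Local Open Scope ereal_scope.
Context d (T : measurableType d) (R : realType).
Variables (q : nat -> {nonneg R}) (x : nat -> nat -> T).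

Definition layer (n : nat) : {measure set T -> \bar R} :=
  mscale (q n) (msum (fun i => \d_(x n i)) n.+1).

Definition atomic : set T -> \bar R := mseries layer 0.

HB.instance Definition _ := Measure.on atomic.

Lemma ge0_integral_layer (f : T -> R) n : measurable_fun setT f -> (forall y, (0 <= f y)%R) ->
  \int[layer n]_y (f y)%:E = ((q n)%:num * \sum_(i < n.+1) f (x n i))%:E.
Proof.
move=> mf f0.
have mf' : measurable_fun setT (EFin \o f) by exact/measurable_EFinP.
rewrite ge0_integral_mscale //; last by move=> y _; rewrite lee_fin.
rewrite ge0_integral_measure_sum //; last by move=> y _; rewrite lee_fin.
rewrite EFinM -sumEFin; congr (_ * _); apply: eq_bigr => i _.
by rewrite integral_dirac // diracT mul1e.
Qed.

Lemma ge0_integral_atomic (f : T -> R) : measurable_fun setT f -> (forall y, (0 <= f y)%R) ->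
  \int[atomic]_y (f y)%:E = \sum_(n <oo) ((q n)%:num * \sum_(i < n.+1) f (x n i))%:E.
Proof.
move=> mf f0.
rewrite ge0_integral_measure_series //; first last.
- exact/measurable_EFinP.
- by move=> y _; rewrite lee_fin.
by apply: eq_eseriesr => n _; rewrite ge0_integral_layer.
Qed.

Lemma atomicE (A : set T) : measurable A ->
  atomic A = \sum_(n <oo) ((q n)%:num * \sum_(i < n.+1) \1_A (x n i))%:E.
Proof.
move=> mA; have mI : measurable_fun setT (\1_A : T -> R) by exact: measurable_indic.
rewrite -ge0_integral_atomic //.
by rewrite integral_indic // setIT.
Qed.

Hypothesis q1 : ((\sum_(k < n) (q k)%:num * k.+1%:R)%R @[n --> \oo] --> (1%R : R)).

(** Layer [k] has mass [(k + 1) q_k], whence the form of [q1]. *)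
Lemma atomic_setT : atomic setT = 1.
Proof.
rewrite atomicE //.
apply/cvg_lim => //.
have -> : (fun n => \sum_(0 <= k < n) ((q k)%:num * \sum_(i < k.+1) \1_[set: T] (x k i))%:E) =
   EFin \o (fun n => \sum_(k < n) (q k)%:num * k.+1%:R)%R.
  apply/funext => n /=; rewrite big_mkord sumEFin; congr EFin; apply: eq_bigr => k _.
  congr (_ * _)%R; under eq_bigr do rewrite indicT.
  by rewrite sumr_const card_ord.
by apply: cvg_EFin => //; near=> n.
Unshelve. all: by end_near. Qed.

HB.instance Definition _ := Measure_isProbability.Build _ _ _ atomic atomic_setT.

Lemma ge0_Rintegral_atomic (f : T -> R) (K : R) : measurable_fun setT f ->
  (forall y, (0 <= f y)%R) -> (forall n i, (i < n.+1)%N -> (f (x n i) <= K)%R) ->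
  \int[atomic]_y (f y)%:E \is a fin_num /\
  (\sum_(n < N) (q n)%:num * \sum_(i < n.+1) f (x n i))%R @[N --> \oo] -->
    fine (\int[atomic]_y (f y)%:E).
Proof.
move=> mf f0 fK.
pose b n : R := ((q n)%:num * \sum_(i < n.+1) f (x n i))%R.
have -> : \int[atomic]_y (f y)%:E = \sum_(n <oo) (b n)%:E by exact: ge0_integral_atomic.
set S := \sum_(n <oo) _.
have b0 n : 0 <= (b n)%:E by rewrite lee_fin mulr_ge0 // sumr_ge0.
have cS : \sum_(0 <= n < N) (b n)%:E @[N --> \oo] --> S.
  by apply: is_cvg_nneseries => n _ _; exact: b0.
have Sfin : S \is a fin_num.
  rewrite ge0_fin_numE ?nneseries_ge0 //.
  have K0 : (0 <= K)%R by apply: le_trans (f0 _) (fK 0%N 0%N isT).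
  apply: (@le_lt_trans _ _ (\int[atomic]_y (cst K y)%:E)); last first.
    have -> : \int[atomic]_y (cst K y)%:E = K%:E * atomic setT by exact: (integral_cst _ _ K%:E).
    by rewrite atomic_setT mule1 ltry.
  rewrite ge0_integral_atomic //.
  apply: lee_nneseries => [n _ _|n _]; first exact: b0.
  by rewrite lee_fin ler_wpM2l // ler_sum // => i _; exact: fK.
split=> //; move: cS; rewrite -{1}(fineK Sfin) => /fine_cvgP[_].
apply: cvg_trans; apply: near_eq_cvg; near=> N.
by rewrite /= big_mkord sumEFin.
Unshelve. all: by end_near. Qed.

(** The bound on [f] is only required at the atoms: the kernels to be
    integrated are unbounded on the plane. *)
Lemma Rintegral_atomic (f : T -> R) (K : R) : measurable_fun setT f ->
  (forall n i, (i < n.+1)%N -> (`|f (x n i)| <= K)%R) ->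
  (\sum_(n < N) (q n)%:num * \sum_(i < n.+1) f (x n i))%R @[N --> \oo] -->
    Rintegral atomic setT f.
Proof.
move=> mf fK.
have hp n i : (i < n.+1)%N -> (f^\+ (x n i) <= K)%R.
  move=> iN; rewrite /funrpos ge_max (le_trans (ler_norm _) (fK n i iN)) /=.
  exact: le_trans (normr_ge0 _) (fK n i iN).
have hn n i : (i < n.+1)%N -> (f^\- (x n i) <= K)%R.
  move=> iN; rewrite /funrneg ge_max (le_trans (normr_ge0 _) (fK n i iN)) andbT.
  by apply: le_trans (fK n i iN); rewrite -normrN ler_norm.
have [pfin cp] := ge0_Rintegral_atomic (measurable_funrpos mf) (funrpos_ge0 f) hp.
have [nfin cn] := ge0_Rintegral_atomic (measurable_funrneg mf) (funrneg_ge0 f) hn.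
rewrite /Rintegral integralE.
have -> : (fun y => (f y)%:E)^\+ = (fun y => (f^\+ y)%:E) by exact: funerpos.
have -> : (fun y => (f y)%:E)^\- = (fun y => (f^\- y)%:E) by exact: funerneg.
rewrite fineB //; apply: cvg_trans (cvgB cp cn); apply: near_eq_cvg; near=> N.
rewrite fctE -sumrB; apply: eq_bigr => n _; rewrite -mulrBr -sumrB; congr (_ * _)%R.
apply: eq_bigr => i _; rewrite /funrpos /funrneg /Num.max.
by case: ltrP; case: ltrP; lra.
Unshelve. all: by end_near. Qed.

Definition atomic_probability : probability T R := atomic.

End AtomicMeasure.

(** * Realizing an expansion by a Cauchy transform *)

(** The logarithmic derivative of [prod ('X - x)]. *)
Lemma sum_inv_roots (F : fieldType) (s : seq F) (z : F) :
  (forall x, x \in s -> z != x) ->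
  \sum_(x <- s) (z - x)^-1 =
  (\prod_(x <- s) ('X - x%:P))^`().[z] / (\prod_(x <- s) ('X - x%:P)).[z].
Proof.
elim: s => [|x s IH] hz; first by rewrite !big_nil derivC horner0 mul0r.
have zx : z - x != 0 by rewrite subr_eq0 hz // mem_head.
have hs y : y \in s -> z != y by move=> ys; apply: hz; rewrite inE ys orbT.
have P0 : (\prod_(x <- s) ('X - x%:P)).[z] != 0.
  by rewrite -[_ != 0]/(~~ root _ z) root_prod_XsubC; apply/negP => /hs; rewrite eqxx.
rewrite !big_cons IH // derivM derivXsubC mul1r hornerD !hornerM hornerXsubC.
by field; rewrite P0 zx.
Qed.

Section PositiveCauchy.
Variable R : realType.
Local Notation C := R[i].

Lemma normc_le_of_power (B : R) (a x : C) d : (0 < d)%N -> 0 <= B ->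
  x ^+ d = a -> normc a <= B ^+ d -> normc x <= B.
Proof.
move=> d0 B0 <-; rewrite normcX => h.
by rewrite -(ler_pXn2r d0) ?nnegrE ?normc_ge0.
Qed.

(** The solutions of [x ^ (n + 1) = a_(n+1)], repeated according to
    multiplicity (when [a_(n+1) = 0]).  The shift makes the index start at 0,
    as the layers do. *)
Definition power_roots (a : nat -> C) (n : nat) : seq C :=
  sval (closed_field_poly_normal ('X^(n.+1) - (a n.+1)%:P)).

Lemma power_rootsE a n : 'X^(n.+1) - (a n.+1)%:P = \prod_(x <- power_roots a n) ('X - x%:P).
Proof.
rewrite /power_roots; case: closed_field_poly_normal => s /= {1}->.
by rewrite (monicP (monicXnsubC _ _)) // scale1r.
Qed.

Lemma size_power_roots a n : size (power_roots a n) = n.+1.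
Proof.
have := size_prod_XsubC (power_roots a n) id.
by rewrite -power_rootsE size_XnsubC // => -[].
Qed.

Lemma mem_power_roots a n x : (x \in power_roots a n) = (x ^+ n.+1 == a n.+1).
Proof. by rewrite -root_prod_XsubC -power_rootsE rootE !hornerE subr_eq0. Qed.

Lemma sum_power_roots a n (z : C) : z != 0 -> z ^+ n.+1 != a n.+1 ->
  \sum_(i < n.+1) (z - nth 0 (power_roots a n) i)^-1 =
  z^-1 * (n.+1%:R / (1 - a n.+1 * z^-1 ^+ n.+1)).
Proof.
move=> z0 za.
have -> : \sum_(i < n.+1) (z - nth 0 (power_roots a n) i)^-1 = \sum_(x <- power_roots a n) (z - x)^-1.
  by rewrite [RHS](big_nth 0) size_power_roots big_mkord.
rewrite sum_inv_roots; last first.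
  by move=> x; rewrite mem_power_roots => xa; apply: contraNneq za => ->.
rewrite -power_rootsE derivB derivC subr0 derivXn hornerMn hornerXn /=.
rewrite hornerD hornerN hornerC hornerXn -mulr_natr exprVn.
have zn0 : z ^+ n.+1 != 0 by rewrite expf_neq0.
have za' : z ^+ n.+1 - a n.+1 != 0 by rewrite subr_eq0.
have -> : (1 - a n.+1 / z ^+ n.+1) = (z ^+ n.+1 - a n.+1) / z ^+ n.+1 by field.
by rewrite invf_div exprS; field; rewrite z0 -exprS za'.
Qed.

(** The weight of degree [n + 1] is shared equally by the [n + 1] roots. *)
Definition layer_weight (n : nat) : {nonneg R} :=
  NngNum (divr_ge0 (weight_ge0 R n.+1) (ler0n R n.+1)).

Lemma sum_layer_weight :
  (\sum_(k < n) (layer_weight k)%:num * k.+1%:R)%R @[n --> \oo] --> (1 : R).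
Proof.
have -> : (fun n => \sum_(k < n) (layer_weight k)%:num * k.+1%:R)%R = (fun n => 1 - harmonic n) :> (nat -> R).
  apply/funext => n; rewrite /harmonic -sum_weight big_add1 /= big_mkord.
  by apply: eq_bigr => k _ /=; rewrite mulfVK // pnatr_eq0.
rewrite -[X in _ --> X]subr0; apply: cvgB; first exact: cvg_cst.
exact: cvg_harmonic.
Qed.

(** The factor [4 ^ n >= n (n + 1)] in [B ^ n] pays for the weight and the
    factor [(1 + 32 K) ^ n] for the constant. *)
Lemma geometric_le_weight (K rho B : R) (n : nat) (x : R) : 0 < rho -> 0 <= K -> (0 < n)%N ->
  B = 4 * (1 + 32 * K) / rho -> x * rho ^+ n <= K -> x <= weight R n / 32 * B ^+ n.
Proof.
move=> rho0 K0 n0 -> hx.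
have rn : 0 < rho ^+ n by rewrite exprn_gt0.
have xle : x <= K / rho ^+ n by rewrite ler_pdivlMr.
apply: le_trans xle _.
rewrite !expr_div_n exprMn !mulrA ler_wpM2r ?invr_ge0 ?(ltW rn) //.
have hn : 1 <= weight R n * 4 ^+ n.
  rewrite mulrC ler_pdivlMr ?ltr0n ?muln_gt0 ?n0 // mul1r -natrX ler_nat.
  rewrite (_ : (4 ^ n = 2 ^ n * 2 ^ n)%N); last by rewrite -expnMn.
  by apply: leq_mul; [apply: ltnW; apply: ltn_expl|apply: ltn_expl].
have hK : 32 * K <= (1 + 32 * K) ^+ n.
  case: n n0 {hx rn hn} => // n _; rewrite exprS.
  apply: le_trans (_ : (1 + 32 * K) * 1 <= _); first by rewrite mulr1 lerDr.
  by rewrite ler_wpM2l ?addr_ge0 ?mulr_ge0 // exprn_ege1 // lerDl mulr_ge0.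
apply: le_trans (_ : (1 + 32 * K) ^+ n / 32 <= _); first by rewrite ler_pdivlMr // mulrC.
have -> : weight R n / 32 * 4 ^+ n * (1 + 32 * K) ^+ n =
    weight R n * 4 ^+ n * ((1 + 32 * K) ^+ n / 32) by ring.
by rewrite ler_peMl // divr_ge0 // exprn_ge0 // addr_ge0 // mulr_ge0.
Qed.

Lemma Re_weighted_sum N (q : nat -> R) (g : nat -> nat -> C) :
  complex.Re (\sum_(n < N) (q n)%:C * \sum_(i < n.+1) g n i) =
  \sum_(n < N) q n * \sum_(i < n.+1) complex.Re (g n i).
Proof.
rewrite (raddf_sum (@complex.Re R)); apply: eq_bigr => n _.
rewrite -(raddf_sum (@complex.Re R)).
by case: (\sum_(i < _) _) => u v /=; rewrite mul0r subr0.
Qed.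

Lemma Im_weighted_sum N (q : nat -> R) (g : nat -> nat -> C) :
  complex.Im (\sum_(n < N) (q n)%:C * \sum_(i < n.+1) g n i) =
  \sum_(n < N) q n * \sum_(i < n.+1) complex.Im (g n i).
Proof.
rewrite (raddf_sum (@complex.Im R)); apply: eq_bigr => n _.
rewrite -(raddf_sum (@complex.Im R)).
by case: (\sum_(i < _) _) => u v /=; rewrite mul0r addr0.
Qed.

Lemma cvg_of_error (s e : nat -> R) (l : R) :
  e N @[N --> \oo] --> 0 -> (forall N, `|l - s N| <= e N) -> s N @[N --> \oo] --> l.
Proof.
move=> e0 h; apply/cvgrPdist_lt => d d0.
move/cvgrPdist_lt: e0 => /(_ _ d0); apply: filterS => N.
rewrite sub0r normrN; apply: le_lt_trans.
exact: le_trans (h N) (ler_norm _).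
Qed.

Lemma cvg_error_term (t K : R) :
  t * (K / 2 ^+ N + (N.+1%:R^-1 + 2 / 2 ^+ N)) @[N --> \oo] --> 0.
Proof.
have g : (2 ^+ N)^-1 @[N --> \oo] --> (0 : R).
  under eq_fun do rewrite -exprVn.
  by apply: cvg_expr; rewrite ger0_norm ?invr_ge0 // invf_lt1 // ltr1n.
have h : (N.+1%:R^-1 : R) @[N --> \oo] --> 0 by exact: cvg_harmonic.
rewrite -[X in _ --> X](_ : t * (K * 0 + (0 + 2 * 0)) = 0); last by ring.
apply: cvgMl_tmp; apply: cvgD; first exact: cvgMl_tmp.
by apply: cvgD => //; exact: cvgMl_tmp.
Qed.

(** The integral of the kernel against the mixture is the limit of the sums
    over the first layers, taken on real and imaginary parts; by
    [sum_power_roots] these sums are [1 / z] times the partial sums of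
    [atoms_approx] at [t = 1 / z], and so they also converge to [w z / c]. *)
Lemma positive_cauchy (w : C -> C) (c : C) (m : nat -> C) (rho K : R) :
  c != 0 -> m 0%N = 0 -> 0 < rho -> (forall n, normc (m n) * rho ^+ n <= K) ->
  near_infty (fun z => forall N,
    normc (z * w z - c - \sum_(n < N.+1) m n * z^-1 ^+ n) <= K / 2 ^+ N) ->
  exists mu : probability (borelC R) R, compact (msupport mu) /\
    near_infty (fun z : C => w z = c * cauchy_transform mu z).
Proof.
move=> c0 m0 rho0 mK hw.
have nc0 : 0 < normc c by rewrite normc_gt0.
have K0 : 0 <= K.
  by apply: le_trans (mK 0%N); rewrite mulr_ge0 ?normc_ge0 ?exprn_ge0 ?(ltW rho0).
pose K' := K / normc c.
have K'0 : 0 <= K' by rewrite divr_ge0 // ltW.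
have [B BE] : exists B, B = 4 * (1 + 32 * K') / rho by eexists.
have B0 : 0 < B.
  by rewrite BE divr_gt0 // mulr_gt0 // ltr_pwDl // mulr_ge0.
pose m' n := m n / c.
have m'B n : (0 < n)%N -> normc (m' n) <= weight R n / 32 * B ^+ n.
  move=> n0; apply: (geometric_le_weight rho0 K'0 n0 BE).
  rewrite normcM normcV mulrAC.
  by rewrite ler_pM2r ?invr_gt0.
pose a := atom m'.
have aB n : (0 < n)%N -> normc (a n) <= B ^+ n.
  move=> n0; apply: le_trans (normc_atom B0 m'B n0) _.
  by rewrite ler_piMr ?exprn_ge0 ?(ltW B0) // invf_le1 // ler1n.
pose x n i : borelC R := nth 0 (power_roots a n) i.
have xB n i : (i < n.+1)%N -> normc (x n i : C) <= B.
  move=> iN; have : x n i \in power_roots a n by rewrite mem_nth // size_power_roots.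
  rewrite mem_power_roots => /eqP xa.
  by apply: (normc_le_of_power _ (ltW B0) xa) => //; exact: aB.
pose mu : probability (borelC R) R := atomic_probability x sum_layer_weight.
exists mu; split.
  apply: (@compact_msupport _ _ B).
  have mU : measurable ([set y | B < normc y] : set (borelC R)).
    apply: sub_sigma_algebra; exact: open_normc_gt.
  rewrite [LHS](atomicE layer_weight x mU) eseries0 // => n _ _.
  rewrite big1 ?mulr0 // => i _; rewrite indicE memNset //=.
  by apply/negP; rewrite -leNgt xB.
(* For [|z| >= 2 B] the kernel is bounded on the disc of the atoms, and [|1 /
   z| * B <= 1 / 2] as [atoms_approx] demands. *)
have B2 : 0 < (2 * B)^-1 by rewrite invr_gt0 mulr_gt0.
apply: near_infty_mono (near_infty_and hw (near_infty_inv B2)) => z [hz [z0 zB]].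
have tB : normc z^-1 * B <= 2^-1.
  by rewrite -ler_pdivlMr // -invfM.
have Bz : B < normc z.
  have nz : 0 < normc z by rewrite normc_gt0.
  move: tB; rewrite normcV ler_pdivrMl // ler_pdivlMr // => h.
  by apply: lt_le_trans h; rewrite ltr_pMr // ltr1n.
have zx n i : (i < n.+1)%N -> normc z - B <= normc (z - x n i).
  move=> iN; rewrite lerBlDr; apply: le_trans (_ : normc (z - x n i) + normc (x n i : C) <= _).
    by rewrite -{1}(subrK (x n i : C) z) le_normcD.
  by rewrite lerD2l xB.
have zB0 : 0 < normc z - B by rewrite subr_gt0.
have kerB n i : (i < n.+1)%N -> normc ((z - x n i)^-1) <= (normc z - B)^-1.
  move=> iN; rewrite normcV lef_pV2 ?posrE ?zx //.
  exact: lt_le_trans (zx _ _ iN).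
pose S N : C := \sum_(n < N) ((layer_weight n)%:num)%:C * \sum_(i < n.+1) (z - x n i)^-1.
have [mRe mIm] := measurable_cauchy_kernel z.
have SE N : S N = z^-1 * \sum_(1 <= d < N.+1) (weight R d)%:C / (1 - a d * z^-1 ^+ d).
  rewrite big_add1 /= big_mkord mulr_sumr; apply: eq_bigr => n _.
  rewrite sum_power_roots //; last first.
    apply/eqP => za; have := aB n.+1 isT; rewrite -za normcX leNgt.
    by rewrite ltrXn2r // ltW.
  rewrite mulrCA; congr (_ * _); rewrite mulrA; congr (_ / _).
  by rewrite -(rmorph_nat (real_complex R)) -rmorphM /= mulfVK // pnatr_eq0.
have cvgRe : (complex.Re (S N)) @[N --> \oo] --> complex.Re (cauchy_transform mu z).
  have -> : (fun N => complex.Re (S N)) = (fun N => \sum_(n < N) (layer_weight n)%:num *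
      \sum_(i < n.+1) complex.Re ((z - x n i)^-1)).
    by apply/funext => N; exact: (Re_weighted_sum N (fun n => (layer_weight n)%:num) (fun n i => (z - x n i)^-1)).
  apply: (Rintegral_atomic sum_layer_weight mRe (K := (normc z - B)^-1)) => n i iN.
  by apply: le_trans (normc_ge_normRe _) (kerB _ _ iN).
have cvgIm : (complex.Im (S N)) @[N --> \oo] --> complex.Im (cauchy_transform mu z).
  have -> : (fun N => complex.Im (S N)) = (fun N => \sum_(n < N) (layer_weight n)%:num *
      \sum_(i < n.+1) complex.Im ((z - x n i)^-1)).
    by apply/funext => N; exact: (Im_weighted_sum N (fun n => (layer_weight n)%:num) (fun n i => (z - x n i)^-1)).
  apply: (Rintegral_atomic sum_layer_weight mIm (K := (normc z - B)^-1)) => n i iN.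
  by apply: le_trans (normc_ge_normIm _) (kerB _ _ iN).
pose err N : R := normc z^-1 * (K' / 2 ^+ N + (N.+1%:R^-1 + 2 / 2 ^+ N)).
have Serr N : normc (w z / c - S N) <= err N.
  pose v := 1 + \sum_(1 <= n < N.+1) m' n * z^-1 ^+ n.
  have -> : w z / c - S N = z^-1 * ((z * w z / c - v) +
     (v - \sum_(1 <= d < N.+1) (weight R d)%:C / (1 - a d * z^-1 ^+ d))).
    by rewrite SE; field; rewrite z0 c0.
  rewrite normcM ler_wpM2l ?normc_ge0 //.
  apply: le_trans (le_normcD _ _) _; apply: lerD; last exact: (atoms_approx B0 m'B).
  have -> : z * w z / c - v = (z * w z - c - \sum_(n < N.+1) m n * z^-1 ^+ n) / c.
    rewrite -(big_mkord xpredT (fun n => m n * z^-1 ^+ n)) big_ltn // m0 mul0r add0r.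
    rewrite !mulrBl divff // opprD addrA; congr (_ - _).
    by rewrite mulr_suml; apply: eq_bigr => n _; rewrite /m' mulrAC.
  rewrite normcM normcV /K' [leRHS]mulrAC.
  by rewrite ler_pM2r ?invr_gt0.
have err0 : err N @[N --> \oo] --> 0.
  exact: cvg_error_term.
have wRe : complex.Re (w z / c) = complex.Re (cauchy_transform mu z).
  apply: (cvg_unique _ _ cvgRe) => //.
  apply: (cvg_of_error err0) => N; rewrite -raddfB.
  exact: le_trans (normc_ge_normRe _) (Serr N).
have wIm : complex.Im (w z / c) = complex.Im (cauchy_transform mu z).
  apply: (cvg_unique _ _ cvgIm) => //.
  apply: (cvg_of_error err0) => N; rewrite -raddfB.
  exact: le_trans (normc_ge_normIm _) (Serr N).
have <- : w z / c = cauchy_transform mu z.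
  by apply/eqP; rewrite eq_complex wRe wIm !eqxx.
by rewrite mulrC divfK.
Qed.

End PositiveCauchy.

Theorem corollary1 (R : realType) (k : nat) (Q : 'I_k.+1 -> {poly R[i]})
    (hQ : general_type Q) (w : R[i] -> R[i]) (hw : branch_near_infty Q w) :
  exists (c : R[i]) (mu : probability (borelC R) R),
    compact (msupport mu) /\
    near_infty (fun z : R[i] => w z = c * cauchy_transform mu z).
Proof.
have [c [m [rho [K [[c0 m0 rho0 mK] hexp]]]]] := branch_expansion hQ hw.
by exists c; apply: positive_cauchy c0 m0 rho0 mK hexp.
Qed.
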